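(* For every integer $k\ge2$, the number of irreducible submodules contained in the space $\mathcal H^{F_4}_k$ of complex homogeneous harmonic polynomials of degree $k$ (that is, the number of irreducible summands when the $\mathcal G^{F_4}$-module $\mathcal H^{F_4}_k$ is decomposed as a direct sum of irreducible submodules) is at least $$\lfloor k/3\rfloor+\lfloor (k-2)/3\rfloor+2.$$
   Context: Notation: $\bar r=27-r$ for $1\le r\le 26$; $\lfloor\cdot\rfloor$ is the integer part. All Lie algebras are over $\mathbb C$. The Lie algebra of type $E_6$. Let $\alpha_1,\dots,\alpha_6$ be the simple roots of $E_6$, with Dynkin diagram edges $1-3$, $3-4$, $4-5$, $5-6$, $2-4$. Let $Q=\sum_i\mathbb Z\alpha_i$ with symmetric bilinear form $(\alpha_i,\alpha_i)=2$, $(\alpha_i,\alpha_j)=-1$ if $i,j$ are adjacent and $0$ otherwise for $i\ne j$, and let $\Phi=\{\alpha\in Q\mid(\alpha,\alpha)=2\}$. Put $$F\Big(\sum_i k_i\alpha_i,\sum_j l_j\alpha_j\Big)=(-1)^{\sum_{i=1}^6k_il_i+k_1l_3+k_4l_2+k_3l_4+k_5l_4+k_6l_5}.$$ Let $H=\bigoplus_i\mathbb C\alpha_i$ (with the form extended bilinearly) and $\mathcal G^{E_6}=H\oplus\bigoplus_{\alpha\in\Phi}\mathbb CE_\alpha$, with bracket $[H,H]=0$, $[h,E_\alpha]=-[E_\alpha,h]=(h,\alpha)E_\alpha$, $[E_\alpha,E_{-\alpha}]=-\alpha$, and, for $\beta\neq-\alpha$, $[E_\alpha,E_\beta]=F(\alpha,\beta)E_{\alpha+\beta}$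 if $\alpha+\beta\in\Phi$ and $0$ otherwise. Let $\sigma$ be the automorphism of $Q$ with $\sigma(\sum k_i\alpha_i)=k_6\alpha_1+k_2\alpha_2+k_5\alpha_3+k_4\alpha_4+k_3\alpha_5+k_1\alpha_6$. It extends linearly to $H$ and induces an automorphism $\hat\sigma$ of $\mathcal G^{E_6}$ of order 2 by $\hat\sigma(E_\alpha)=E_{\sigma(\alpha)}$ and $\hat\sigma|_H=\sigma$. The Lie algebra of type $F_4$ and its basic module. $\mathcal G^{F_4}=\{u\in\mathcal G^{E_6}\mid\hat\sigma(u)=u\}$ is the simple Lie algebra of type $F_4$. The space $V=\{w\in\mathcal G^{E_6}\mid\hat\sigma(w)=-w\}$, with the adjoint action of $\mathcal G^{F_4}$, is the basic 26-dimensional irreducible module. It has basis $x_1,\dots,x_{26}$, where for $1\le r\le12$ $$x_r=E_{\beta_r}-E_{\sigma(\beta_r)},\qquad x_{27-r}=E_{-\beta_r}-E_{-\sigma(\beta_r)},$$ $\beta_1=\alpha_1+\alpha_2+2\alpha_3+2\alpha_4+\alpha_5+\alpha_6$, $\beta_2=\alpha_1+\alpha_2+2\alpha_3+2\alpha_4+\alpha_5$, $\beta_3=\alpha_1+\alpha_2+\alpha_3+2\alpha_4+\alpha_5$, $\beta_4=\alpha_1+\alpha_2+\alpha_3+\alpha_4+\alpha_5$, $\beta_5=\alpha_1+\alpha_2+\alpha_3+\alpha_4$, $\beta_6=\alpha_1+\alpha_3+\alpha_4+\alpha_5$, $\beta_7=\alpha_2+\alpha_3+\alpha_4$, $\beta_8=\alpha_1+\alpha_3+\alpha_4$,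 $\beta_9=\alpha_3+\alpha_4$, $\beta_{10}=\alpha_1+\alpha_3$, $\beta_{11}=\alpha_3$, $\beta_{12}=\alpha_1$, and $x_{13}=\alpha_1-\alpha_6$, $x_{14}=\alpha_3-\alpha_5$. The polynomial representation. $\mathcal A=\mathbb C[x_1,\dots,x_{26}]$ is the polynomial algebra in the $x_r$ treated as commuting variables; $\mathcal G^{F_4}$ acts on $\mathcal A$ by derivations extending its action on $V=\sum_r\mathbb Cx_r$. $\mathcal A_k$ is the subspace of homogeneous polynomials of degree $k$, a finite-dimensional $\mathcal G^{F_4}$-submodule. Harmonic polynomials. The polynomial $\eta_1=3\sum_{r=1}^{12}x_rx_{\bar r}-x_{13}^2-x_{13}x_{14}-x_{14}^2$ is a quadratic $\mathcal G^{F_4}$-invariant. The $\mathcal G^{F_4}$-invariant (i.e. commuting with the action of $\mathcal G^{F_4}$ on $\mathcal A$) complex Laplace operator dual to $\eta_1$ is, up to a nonzero scalar, $$\Delta_{F_4}=\sum_{r=1}^{12}\partial_{x_r}\partial_{x_{\bar r}}-\partial_{x_{13}}^2+\partial_{x_{13}}\partial_{x_{14}}-\partial_{x_{14}}^2,$$ and $\mathcal H^{F_4}_k=\{f\in\mathcal A_k\mid\Delta_{F_4}(f)=0\}$, which is a $\mathcal G^{F_4}$-submodule of $\mathcal A_k$. *)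

(* Defs.v *)
From HB Require Import structures.
From mathcomp Require Import all_boot all_order all_algebra.
From mathcomp Require Import zify ring lra.
From mathcomp Require Import reals complex mpoly.

Set Implicit Arguments.
Unset Strict Implicit.
Unset Printing Implicit Defensive.

Import Order.TTheory GRing.Theory Num.Theory.
Local Open Scope ring_scope.

(* A lattice vector \sum_i k_i alpha_i (or an element of its scalar extension
   H) is the row of its coordinates. The formulas below number them from 1:
   [co k i] is k_i for 1 <= i <= 6, stored at position i - 1. *)
Notation lattice := 'rV[int]_6.

Definition co (T : Type) (k : 'rV[T]_6) (i : nat) : T := k 0 (inord i.-1).

Definition vec6 (T : nmodType) (k1 k2 k3 k4 k5 k6 : T) : 'rV[T]_6 :=
  \row_(i < 6) [:: k1; k2; k3; k4; k5; k6]`_i.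

Definition E6_edges : seq (nat * nat) :=
  [:: (1, 3); (3, 4); (4, 5); (5, 6); (2, 4)]%N.

Definition E6_adj (i j : nat) : bool :=
  ((i, j) \in E6_edges) || ((j, i) \in E6_edges).

Definition E6_gram (i j : nat) : int :=
  if i == j then 2 else if E6_adj i j then -1 else 0.

Definition E6_form (T : comNzRingType) (k l : 'rV[T]_6) : T :=
  \sum_(1 <= i < 7) \sum_(1 <= j < 7) co k i * co l j * (E6_gram i j)%:~R.

Definition is_root (a : lattice) : bool := E6_form a a == 2.

Record E6_root := E6Root { root_val :> lattice; _ : is_root root_val }.

HB.instance Definition _ := [isSub for root_val].
HB.instance Definition _ := [Countable of E6_root by <:].

Lemma E6_formE (T : comNzRingType) (a : 'rV[T]_6) :
  E6_form a a = 2 * (co a 1 ^+ 2 + co a 2 ^+ 2 + co a 3 ^+ 2 + co a 4 ^+ 2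
    + co a 5 ^+ 2 + co a 6 ^+ 2 - co a 1 * co a 3 - co a 3 * co a 4
    - co a 4 * co a 5 - co a 5 * co a 6 - co a 2 * co a 4).
Proof.
rewrite /E6_form /E6_gram /E6_adj unlock /=.
by rewrite ?(rmorphN, rmorph0, rmorph1) /= -?pmulrn; ring.
Qed.

Lemma root_bound (r : E6_root) (i : 'I_6) : `|root_val r 0 i| <= 3.
Proof.
case: r => a /= /eqP; rewrite E6_formE => aa.
have sq (x : int) : 0 <= x ^+ 2 by exact: sqr_ge0.
have le j : (0 < j < 7)%N -> co a j ^+ 2 <= 12.
  have := (sq (2 * co a 2 - co a 4), sq (2 * co a 1 - co a 3),
    sq (3 * co a 3 - 2 * co a 4), sq (2 * co a 6 - co a 5),
    sq (3 * co a 5 - 2 * co a 4), sq (5 * co a 4 - 6 * co a 3)).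
  have := (sq (4 * co a 3 - 5 * co a 1), sq (2 * co a 4 - 3 * co a 2),
    sq (5 * co a 4 - 6 * co a 5), sq (4 * co a 5 - 5 * co a 6)).
  move: aa; case: j => [|[|[|[|[|[|[|//]]]]]]] // aa;
    by case=> [[[? ?] ?] ?]; case=> [[[[[? ?] ?] ?] ?] ?] _; lra.
have := le i.+1; rewrite /co /= inord_val ltnS ltn_ord => /(_ isT).
rewrite -real_normK ?num_real // => le12; rewrite leNgt -lez1D.
by apply/negP => le4; nra.
Qed.

Definition root_code (r : E6_root) : {ffun 'I_6 -> 'I_7} :=
  [ffun i => inord (absz (root_val r 0 i + 3))].

Definition root_decode (f : {ffun 'I_6 -> 'I_7}) : option E6_root :=
  insub (\row_i ((f i : nat)%:Z - 3)).

Lemma root_codeK : pcancel root_code root_decode.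
Proof.
move=> r; rewrite /root_decode.
suff -> : \row_i ((root_code r i : nat)%:Z - 3) = root_val r by rewrite valK.
apply/rowP => i; rewrite mxE ffunE.
have := root_bound r i; rewrite ler_norml => /andP[].
move: (root_val r 0 i) => x ge3 le3; by rewrite inordK; lia.
Qed.

HB.instance Definition _ : isFinite E6_root := PCanIsFinite root_codeK.

Definition E6_sign (C : fieldType) (k l : lattice) : C :=
  (-1) ^ (\sum_(1 <= i < 7) co k i * co l i
          + co k 1 * co l 3 + co k 4 * co l 2 + co k 3 * co l 4
          + co k 5 * co l 4 + co k 6 * co l 5).

(* The Lie algebra of type E_6: pairs of an element of H and the family of
   coefficients of the root vectors E_alpha. *)
Notation lieE6 C := ('rV[C]_6 * {ffun E6_root -> C^o})%type.

Definition cartan_vec (C : fieldType) (h : 'rV[C]_6) : lieE6 C := (h, 0).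

(* E_a when a is a root, and 0 for any other lattice vector a. *)
Definition root_vec (C : fieldType) (a : lattice) : lieE6 C :=
  (0, [ffun r : E6_root => (root_val r == a)%:R]).

Definition lattice_in_H (C : fieldType) (a : lattice) : 'rV[C]_6 :=
  map_mx intr a.

Definition root_bracket (C : fieldType) (a b : lattice) : lieE6 C :=
  if b == - a then cartan_vec (- lattice_in_H C a)
  else if is_root (a + b) then E6_sign C a b *: root_vec C (a + b)
  else 0.

(* The bilinear extension of the brackets of H and the root vectors. *)
Definition bracket (C : fieldType) (u v : lieE6 C) : lieE6 C :=
  \sum_(b : E6_root)
     (v.2 b * E6_form u.1 (lattice_in_H C (root_val b))) *: root_vec C b
  - \sum_(a : E6_root)
     (u.2 a * E6_form v.1 (lattice_in_H C (root_val a))) *: root_vec C a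
  + \sum_(a : E6_root) \sum_(b : E6_root)
     (u.2 a * v.2 b) *: root_bracket C a b.

(* The diagram automorphism, on the lattice and on H alike. *)
Definition sigma (T : nmodType) (k : 'rV[T]_6) : 'rV[T]_6 :=
  vec6 (co k 6) (co k 2) (co k 5) (co k 4) (co k 3) (co k 1).

Definition sigma_hat (C : fieldType) (u : lieE6 C) : lieE6 C :=
  cartan_vec (sigma u.1)
  + \sum_(a : E6_root) u.2 a *: root_vec C (sigma (root_val a)).

Definition lieF4 (C : fieldType) : {pred lieE6 C} :=
  [pred u | sigma_hat u == u].
Arguments lieF4 : clear implicits.

Definition betas : seq lattice :=
  [:: vec6 1 1 2 2 1 1; vec6 1 1 2 2 1 0; vec6 1 1 1 2 1 0;
      vec6 1 1 1 1 1 0; vec6 1 1 1 1 0 0; vec6 1 0 1 1 1 0;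
      vec6 0 1 1 1 0 0; vec6 1 0 1 1 0 0; vec6 0 0 1 1 0 0;
      vec6 1 0 1 0 0 0; vec6 0 0 1 0 0 0; vec6 1 0 0 0 0 0].

Definition beta (r : nat) : lattice := betas`_r.-1.

(* The basis x_1, ..., x_26 of the (-1)-eigenspace V of sigma_hat. *)
Definition xvec (C : fieldType) (r : nat) : lieE6 C :=
  if (r <= 12)%N then root_vec C (beta r) - root_vec C (sigma (beta r))
  else if r == 13 then cartan_vec (vec6 1 0 0 0 0 (-1))
  else if r == 14 then cartan_vec (vec6 0 0 1 0 (-1) 0)
  else root_vec C (- beta (27 - r)) - root_vec C (- sigma (beta (27 - r))).

Definition xbasis (C : fieldType) : 26.-tuple (lieE6 C) :=
  [tuple xvec C i.+1 | i < 26].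

(* The variable x_(s + 1) of the polynomial algebra is 'X_s. This is the
   polynomial [g, x_(r + 1)], an element of the span V of the x's. *)
Definition act_var (C : fieldType) (g : lieE6 C) (r : 'I_26) :
    {mpoly C[26]} :=
  \sum_(s < 26) coord (xbasis C) s (bracket g (tnth (xbasis C) r)) *: 'X_s.

(* The derivation of the polynomial algebra that extends [g, _]. *)
Definition act (C : fieldType) (g : lieE6 C) (p : {mpoly C[26]}) :
    {mpoly C[26]} :=
  \sum_(r < 26) act_var g r * p^`M(r).

Definition xvar (r : nat) : 'I_26 := inord r.-1.

Definition laplacian (C : fieldType) (p : {mpoly C[26]}) : {mpoly C[26]} :=
  \sum_(1 <= r < 13) p^`M(xvar (27 - r))^`M(xvar r)
  - p^`M(xvar 13)^`M(xvar 13) + p^`M(xvar 14)^`M(xvar 13)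
  - p^`M(xvar 14)^`M(xvar 14).

Lemma actX (C : fieldType) (g : lieE6 C) (r : 'I_26) :
  act g 'X_r = act_var g r.
Proof.
rewrite /act (bigD1 r) //= big1 => [|s sr]; rewrite mderivX mnm1E.
  by rewrite eqxx scale1r -[X in (X - _)%MM]add0m addmK mpolyX0 mulr1 addr0.
by rewrite eq_sym (negbTE sr) scale0r mulr0.
Qed.

Lemma actM (C : fieldType) (g : lieE6 C) (p q : {mpoly C[26]}) :
  act g (p * q) = act g p * q + p * act g q.
Proof.
rewrite /act mulr_suml mulr_sumr -big_split; apply: eq_bigr => r _ /=.
by rewrite mderivM; ring.
Qed.

Lemma mderiv_homog (C : fieldType) (n d : nat) (i : 'I_n)
    (p : {mpoly C[n]}) :
  p \is d.-homog -> p^`M(i) \is d.-1.-homog.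
Proof.
move=> /dhomogP hp; rewrite [p]mpolyE raddf_sum big_seq.
apply: rpred_sum => m /hp <-; rewrite /= mderivZ mderivX rpredZ //.
have [-> | mi] := posnP (m i); first by rewrite scale0r rpred0.
rewrite rpredZ // dhomogX.
suff {2}<- : (m - U_(i) + U_(i))%MM = m by rewrite mdegD mdeg1 addn1.
by apply/submK/mnm_lepP => j; rewrite mnm1E; case: eqP => // <-.
Qed.

Lemma mderiv_homog0 (C : fieldType) (n : nat) (i : 'I_n)
    (p : {mpoly C[n]}) :
  p \is 0.-homog -> p^`M(i) = 0.
Proof.
move=> /dhomogP hp; rewrite [p]mpolyE raddf_sum big_seq big1 //= => m /hp.
by move=> /eqP; rewrite mdeg_eq0 => /eqP ->; rewrite mpolyX0 mderivZ mderivC scaler0.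
Qed.

Lemma act_homog (C : fieldType) (k : nat) (g : lieE6 C)
    (p : {mpoly C[26]}) :
  p \is k.-homog -> act g p \is k.-homog.
Proof.
move=> hp; apply: rpred_sum => r _; case: k => [|k] in hp *.
  by rewrite mderiv_homog0 // mulr0 rpred0.
apply: (@dhomogM _ _ _ 1 _ k); last exact: mderiv_homog hp.
by apply: rpred_sum => s _; rewrite rpredZ // dhomogX /= mdeg1.
Qed.

Lemma laplacian_homog (C : fieldType) (k : nat) (p : {mpoly C[26]}) :
  p \is k.-homog -> laplacian p \is (k - 2).-homog.
Proof.
move=> hp; rewrite subn2.
have hd (i j : 'I_26) : p^`M(i)^`M(j) \is k.-2.-homog.
  by do 2!apply: mderiv_homog.
apply: rpredB (hd _ _); apply: rpredD (hd _ _); apply: rpredB (hd _ _).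
by apply: rpred_sum => r _; exact: hd.
Qed.

Notation polyA C k := (dhomog 26 C k).

Definition act_homogeneous (C : fieldType) (k : nat) (g : lieE6 C)
    (f : polyA C k) : polyA C k :=
  DHomog (act_homog g (valP f)).

Definition laplacian_homogeneous (C : fieldType) (k : nat) (f : polyA C k) :
    polyA C (k - 2) :=
  DHomog (laplacian_homog (valP f)).

Lemma laplacian_homogeneous_is_linear (C : fieldType) (k : nat) :
  linear (@laplacian_homogeneous C k).
Proof.
move=> c p q; apply: val_inj; rewrite /= /laplacian.
have d2 (i j : 'I_26) : (c *: val p + val q)^`M(i)^`M(j)
    = c *: (val p)^`M(i)^`M(j) + (val q)^`M(i)^`M(j).
  by rewrite !(mderivD, mderivZ).
under eq_bigr => r _ do rewrite d2.
by rewrite !d2 big_split -scaler_sumr /= -!mul_mpolyC; ring.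
Qed.

HB.instance Definition _ (C : fieldType) (k : nat) :=
  GRing.isLinear.Build C (polyA C k) (polyA C (k - 2)) _
    (@laplacian_homogeneous C k) (@laplacian_homogeneous_is_linear C k).

Definition harmonic (C : fieldType) (k : nat) : {vspace polyA C k} :=
  lker (linfun (@laplacian_homogeneous C k)).

Lemma harmonicE (C : fieldType) (k : nat) (f : polyA C k) :
  (f \in harmonic C k) = (laplacian (val f) == 0).
Proof. by rewrite memv_ker lfunE. Qed.

Definition submodule (C : fieldType) (k : nat) (W : {vspace polyA C k}) :
    Prop :=
  forall (g : lieE6 C) (f : polyA C k),
    g \in lieF4 C -> f \in W -> act_homogeneous g f \in W.

Definition irreducible_submodule (C : fieldType) (k : nat)
    (W : {vspace polyA C k}) : Prop :=
  [/\ submodule W, W != 0%VS &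
    forall U : {vspace polyA C k},
      submodule U -> (U <= W)%VS -> U = 0%VS \/ U = W].

Definition irreducible_decomposition (C : fieldType) (k : nat)
    (M : {vspace polyA C k}) (n : nat) (W : 'I_n -> {vspace polyA C k}) :
    Prop :=
  [/\ forall i, irreducible_submodule (W i),
      directv (\sum_(i < n) W i) &
      (\sum_(i < n) W i)%VS = M].

(* Main.v *)
Require Import Defs.
From HB Require Import structures.
From mathcomp Require Import all_boot all_order all_algebra.
From mathcomp Require Import zify ring lra.
From mathcomp Require Import boolp reals complex mpoly.
Set Implicit Arguments.
Unset Strict Implicit.
Unset Printing Implicit Defensive.
Import Order.TTheory GRing.Theory Num.Theory.
Local Open Scope ring_scope.

(** The number of irreducible summands of a semisimple highest weight module is
    the dimension of its space of singular vectors (the vectors killed by the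
    raising operators), so the bound follows once enough independent singular
    harmonic polynomials are known. There are two basic ones besides x_1: the
    quadratic [zeta1], of the same weight as x_1, and the cubic [zeta2], whose
    weight is that of x_1 x_2. Their monomials x_1^a zeta1^b zeta2^c are
    singular, the raising operators being derivations. They are harmonic when
    [b <= 1]: the Laplacian is a second order operator, with an associated
    symmetric bilinear form [gamma] on gradients, and all the values of [gamma]
    on pairs from x_1, [zeta1], [zeta2] vanish, except on (zeta1, zeta1)
    ([zeta_monomial_diff2]). In degree [k] there are [k %/ 3 + 1] such monomials
    with [b = 0] and [(k - 2) %/ 3 + 1] with [b = 1], and their weights are
    pairwise distinct.

    A derivation of the polynomial algebra that preserves degrees is given by a
    26 x 26 matrix ([der]), and commutators of derivations are commutators of
    matrices ([der_comm]). The matrices of the root vectors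
    [E_a + E_(sigma a)] and of the coroots have integer entries, which
    [root_table] and [cartan_table] compute from the definition of the bracket
    ([adV_root], [adV_cartan]). All that is used of the Lie algebra structure is
    then a finite list of matrix identities: the Chevalley relations between
    raising, lowering and Cartan operators, and the fact that each root vector
    is, up to a nonzero scalar, a commutator of one attached to a simple root or
    its opposite and one attached to a shorter vector ([root_steps]). Hence a
    subspace is a submodule as soon as it is stable under the operators attached
    to simple roots and their opposites ([submoduleP]).

    The other ingredient is a positive definite Hermitian form on each space of homogeneous polynomials ([herm]) for which raising and
    lowering operators are adjoint up to sign. Orthogonal complements of
    submodules are submodules, which gives complete reducibility
    ([decomposition_exists]). The same form shows that, in an irreducible
    submodule, a singular vector orthogonal to a singular weight vector is zero
    ([singular_orth]): the subspace generated from the latter by the lowering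
    operators is a submodule, hence contains the whole irreducible one, and it is
    orthogonal to the former. So an irreducible summand cannot contain singular vectors of
    different weights, and projecting singular vectors of distinct weights to
    the summands gives an injection of the set of these vectors into the set of
    summands ([singular_count]). *)

(** * Linear vector fields and second order operators *)

Section LinearVectorFields.
Variables (C : fieldType) (n : nat).
Implicit Types (p q : {mpoly C[n]}) (M N K : 'M[C]_n) (v : 'rV[C]_n).

Definition linear_form v : {mpoly C[n]} := \sum_(s < n) v 0 s *: 'X_s.

Definition ddir v p : {mpoly C[n]} := \sum_(r < n) v 0 r *: p^`M(r).

(** The derivation that maps the variable of index [r] to the linear form of
    row [r] of [M]; every degree-preserving linear derivation has this form. *)
Definition der M p : {mpoly C[n]} :=
  \sum_(r < n) linear_form (row r M) * p^`M(r).

(** The polarization of [diff2 K], see [diff2M]. *)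
Definition gamma K p q : {mpoly C[n]} :=
  \sum_(r < n) \sum_(s < n) K r s *: (p^`M(r) * q^`M(s)).

Definition diff2 K p : {mpoly C[n]} :=
  \sum_(r < n) \sum_(s < n) K r s *: p^`M(r)^`M(s).

Lemma mderiv_var (r s : 'I_n) : ('X_s : {mpoly C[n]})^`M(r) = (s == r)%:R.
Proof.
rewrite mderivX mnm1E; case: eqP => [->|_]; last by rewrite scale0r.
by rewrite scale1r -[X in (X - _)%MM]add0m addmK mpolyX0.
Qed.

Lemma linear_form_is_linear : linear linear_form.
Proof.
move=> a u v; rewrite /linear_form scaler_sumr -big_split /=.
by apply: eq_bigr => s _; rewrite !mxE scalerDl scalerA.
Qed.
HB.instance Definition _ :=
  GRing.isLinear.Build C _ _ _ linear_form linear_form_is_linear.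

Lemma linear_form_mderiv v r : (linear_form v)^`M(r) = (v 0 r)%:MP.
Proof.
rewrite /linear_form raddf_sum (bigD1 r) //= big1 => [|s sr].
  by rewrite mderivZ mderiv_var eqxx addr0 -mul_mpolyC mulr1.
by rewrite mderivZ mderiv_var (negbTE sr) scaler0.
Qed.

Lemma linear_form_homog v : linear_form v \is 1.-homog.
Proof. by apply: rpred_sum => s _; rewrite rpredZ // dhomogX /= mdeg1. Qed.

Lemma der_is_linear M : linear (der M).
Proof.
move=> a p q; rewrite /der scaler_sumr -big_split; apply: eq_bigr => r _ /=.
by rewrite mderivD mderivZ mulrDr scalerAr.
Qed.
HB.instance Definition _ M :=
  GRing.isLinear.Build C _ _ _ (der M) (der_is_linear M).

Lemma ddir_is_linear v : linear (ddir v).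
Proof.
move=> a p q; rewrite /ddir scaler_sumr -big_split; apply: eq_bigr => r _ /=.
by rewrite mderivD mderivZ scalerDr !scalerA mulrC.
Qed.
HB.instance Definition _ v :=
  GRing.isLinear.Build C _ _ _ (ddir v) (ddir_is_linear v).

Lemma diff2_is_linear K : linear (diff2 K).
Proof.
move=> a p q; rewrite /diff2 scaler_sumr -big_split; apply: eq_bigr => r _ /=.
rewrite scaler_sumr -big_split; apply: eq_bigr => s _ /=.
by rewrite !(mderivD, mderivZ) scalerDr !scalerA mulrC.
Qed.
HB.instance Definition _ K :=
  GRing.isLinear.Build C _ _ _ (diff2 K) (diff2_is_linear K).

Lemma derX M r : der M 'X_r = linear_form (row r M).
Proof.
rewrite /der (bigD1 r) //= big1 => [|s sr].
  by rewrite mderiv_var eqxx mulr1 addr0.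
by rewrite mderiv_var eq_sym (negbTE sr) mulr0.
Qed.

Lemma derM M p q : der M (p * q) = der M p * q + p * der M q.
Proof.
rewrite /der mulr_suml mulr_sumr -big_split; apply: eq_bigr => r _ /=.
by rewrite mderivM; ring.
Qed.

Lemma derC M c : der M c%:MP = 0.
Proof. by rewrite /der big1 // => r _; rewrite mderivC mulr0. Qed.

Lemma der1 M : der M 1 = 0. Proof. exact: derC. Qed.

Lemma derD M N p : der (M + N) p = der M p + der N p.
Proof.
rewrite /der -big_split; apply: eq_bigr => r _ /=.
by rewrite linearD /= linearD mulrDl.
Qed.

Lemma derZ c M p : der (c *: M) p = c *: der M p.
Proof.
rewrite /der scaler_sumr; apply: eq_bigr => r _ /=.
by rewrite linearZ /= linearZ scalerAl.
Qed.

Lemma der0 p : der 0 p = 0.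
Proof. by rewrite -(scale0r 0) derZ scale0r. Qed.

Lemma derN M p : der (- M) p = - der M p.
Proof. by rewrite -scaleN1r derZ scaleN1r. Qed.

Lemma der_homog M k p : p \is k.-homog -> der M p \is k.-homog.
Proof.
move=> hp; apply: rpred_sum => r _; case: k => [|k] in hp *.
  by rewrite mderiv_homog0 // mulr0 rpred0.
by apply: (@dhomogM _ _ _ 1 _ k); [exact: linear_form_homog|exact: mderiv_homog hp].
Qed.

Lemma mderiv_der M p i :
  (der M p)^`M(i) = der M p^`M(i) + ddir (row i M^T) p.
Proof.
rewrite /der /ddir raddf_sum -big_split; apply: eq_bigr => r _ /=.
by rewrite mderivM linear_form_mderiv !mxE mul_mpolyC addrC mderiv_comm.
Qed.

(** Composing linear vector fields reverses the order of the matrices, since a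
    matrix lists the images of the variables by rows. *)
Lemma der_comm M N p :
  der M (der N p) - der N (der M p) = der (N *m M - M *m N) p.
Proof.
have composite A B : der A (der B p) = der (B *m A) p
   + \sum_(r < n) \sum_(s < n)
       linear_form (row r B) * linear_form (row s A) * p^`M(r)^`M(s).
  rewrite {2}/der raddf_sum /= -big_split; apply: eq_bigr => r _ /=.
  rewrite derM; congr (_ + _).
    congr (_ * _); rewrite /linear_form raddf_sum /=.
    under eq_bigr => s _ do rewrite linearZ /= derX /linear_form scaler_sumr.
    rewrite exchange_big; apply: eq_bigr => t _ /=.
    under eq_bigr => s _ do rewrite scalerA.
    rewrite -scaler_suml !mxE; congr (_ *: _).
    by apply: eq_bigr => s _; rewrite !mxE.
  rewrite /der mulr_sumr; apply: eq_bigr => s _ /=.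
  by rewrite mulrA.
rewrite !composite [X in _ + X - _]exchange_big /= derD derN opprD addrACA.
rewrite [X in _ + X](_ : _ = 0) ?addr0 //.
apply/eqP; rewrite subr_eq0; apply/eqP; apply: eq_bigr => r _.
by apply: eq_bigr => s _; rewrite mderiv_comm [X in X * _]mulrC.
Qed.

Lemma gammaC K p q : K^T = K -> gamma K p q = gamma K q p.
Proof.
move=> KT; rewrite /gamma exchange_big; apply: eq_bigr => r _.
by apply: eq_bigr => s _; rewrite -{1}KT mxE mulrC.
Qed.

Lemma gamma_is_linear K p : linear (gamma K p).
Proof.
move=> a q q'; rewrite /gamma scaler_sumr -big_split; apply: eq_bigr => r _ /=.
rewrite scaler_sumr -big_split; apply: eq_bigr => s _ /=.
by rewrite !(mderivD, mderivZ) mulrDr scalerDr -scalerAr !scalerA mulrC.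
Qed.
HB.instance Definition _ K p :=
  GRing.isLinear.Build C _ _ _ (gamma K p) (gamma_is_linear K p).

Lemma gammaMr K p q q' :
  gamma K p (q * q') = gamma K p q * q' + q * gamma K p q'.
Proof.
rewrite /gamma mulr_suml mulr_sumr -big_split; apply: eq_bigr => r _ /=.
rewrite mulr_suml mulr_sumr -big_split; apply: eq_bigr => s _ /=.
by rewrite mderivM -!mul_mpolyC; ring.
Qed.

Lemma gammaX K r s : gamma K 'X_r 'X_s = (K r s)%:MP.
Proof.
rewrite /gamma (bigD1 r) //= [X in _ + X]big1 => [|i ir]; last first.
  by rewrite big1 // => j _; rewrite mderiv_var eq_sym (negbTE ir) mul0r scaler0.
rewrite (bigD1 s) //= big1 => [|j js]; last first.
  by rewrite [X in _ * X]mderiv_var eq_sym (negbTE js) mulr0 scaler0.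
by rewrite !mderiv_var !eqxx mulr1 !addr0 -mul_mpolyC mulr1.
Qed.

Lemma diff2M K p q : K^T = K ->
  diff2 K (p * q) = diff2 K p * q + p * diff2 K q + gamma K p q *+ 2.
Proof.
move=> KT; rewrite mulr2n {2}(gammaC _ _ KT).
rewrite /diff2 /gamma mulr_suml mulr_sumr -!big_split; apply: eq_bigr => r _ /=.
rewrite mulr_suml mulr_sumr -!big_split; apply: eq_bigr => s _ /=.
by rewrite !(mderivM, mderivD) -!mul_mpolyC; ring.
Qed.

Lemma diff2X K r : diff2 K 'X_r = 0.
Proof.
rewrite /diff2 big1 // => i _; rewrite big1 // => j _.
by rewrite mderiv_var; case: (_ == _); rewrite ?mderiv0 -?mpolyC1 ?mderivC scaler0.
Qed.

(** Moving the vector field past one of the two partial derivatives makes [M]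
    act on the corresponding index of [K], as in the action of matrices on
    tensors of order two. *)
Lemma diff2_der K M p : M *m K + K *m M^T = 0 ->
  diff2 K (der M p) = der M (diff2 K p).
Proof.
move=> inv; apply/eqP; rewrite -subr_eq0; apply/eqP.
have -> : diff2 K (der M p) - der M (diff2 K p) =
    diff2 (M *m K + K *m M^T) p.
  transitivity (\sum_(i < n) \sum_(j < n)
    K i j *: (ddir (row i M^T) p^`M(j) + ddir (row j M^T) p^`M(i))).
    rewrite /diff2 (raddf_sum (der M)) /= -sumrB; apply: eq_bigr => i _.
    rewrite (raddf_sum (der M)) /= -sumrB; apply: eq_bigr => j _.
    rewrite (linearZZ (der M)) -scalerBr; congr (_ *: _).
    rewrite mderiv_der mderivD mderiv_der.
    have -> : (ddir (row i M^T) p)^`M(j) = ddir (row i M^T) p^`M(j).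
      rewrite /ddir raddf_sum; apply: eq_bigr => r _.
      by rewrite /= mderivZ mderiv_comm.
    by ring.
  under eq_bigr => i _ do under eq_bigr => j _ do rewrite scalerDr.
  under eq_bigr => i _ do rewrite big_split /=.
  rewrite big_split /= /diff2.
  have -> : \sum_(r < n) \sum_(s < n) (M *m K + K *m M^T) r s *: p^`M(r)^`M(s)
     = \sum_(r < n) \sum_(s < n) (M *m K) r s *: p^`M(r)^`M(s)
     + \sum_(r < n) \sum_(s < n) (K *m M^T) r s *: p^`M(r)^`M(s).
    rewrite -big_split; apply: eq_bigr => r _; rewrite -big_split /=.
    by apply: eq_bigr => s _; rewrite mxE scalerDl.
  congr (_ + _).
    rewrite exchange_big [RHS]exchange_big; apply: eq_bigr => j _ /=.
    rewrite /ddir; under eq_bigr => i _ do rewrite scaler_sumr.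
    rewrite exchange_big; apply: eq_bigr => r _ /=.
    rewrite mxE scaler_suml; apply: eq_bigr => i _.
    by rewrite !mxE scalerA mulrC mderiv_comm.
  apply: eq_bigr => i _; rewrite /ddir.
  under eq_bigr => j _ do rewrite scaler_sumr.
  rewrite exchange_big; apply: eq_bigr => s _ /=.
  rewrite mxE scaler_suml; apply: eq_bigr => j _.
  by rewrite !mxE scalerA.
rewrite inv /diff2 big1 // => i _; rewrite big1 // => j _.
by rewrite mxE scale0r.
Qed.

End LinearVectorFields.

(** * A positive definite Hermitian form on homogeneous polynomials *)

Section HermitianForm.
Variables (C : numClosedFieldType) (n m : nat) (L : 'M[C]_(m, n)).
Implicit Types (p q : {mpoly C[n]}) (M N : 'M[C]_n).

(** A Fischer form. The recursion on the degree makes both positivity and the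
    computation of adjoints one-step inductions; the rows of [L] are directions
    that make [gram L] the Gram matrix of the variables, which need not be
    orthogonal. *)
Fixpoint herm (k : nat) p q : C :=
  if k is k'.+1 then
    \sum_(t < m) herm k' (ddir (row t L) p) (ddir (row t L) q)
  else p@_0%MM * (q@_0%MM)^*.

Lemma hermC k p q : herm k q p = (herm k p q)^*.
Proof.
elim: k p q => [|k IH] p q /=; first by rewrite (rmorphM Num.conj) /= conjCK mulrC.
by rewrite rmorph_sum; apply: eq_bigr => t _; exact: IH.
Qed.

Lemma hermPl k a p p' q : herm k (a *: p + p') q = a * herm k p q + herm k p' q.
Proof.
elim: k p p' q => [|k IH] p p' q /=.
  by rewrite mcoeffD mcoeffZ mulrDl mulrA.
rewrite mulr_sumr -big_split; apply: eq_bigr => t _ /=.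
by rewrite linearP IH.
Qed.

Lemma hermDl k p p' q : herm k (p + p') q = herm k p q + herm k p' q.
Proof. by rewrite -[p]scale1r hermPl scale1r mul1r. Qed.

Lemma herm0l k q : herm k 0 q = 0.
Proof. by apply: (addrI (herm k 0 q)); rewrite -hermDl !addr0. Qed.

Lemma hermZl k a p q : herm k (a *: p) q = a * herm k p q.
Proof. by rewrite -[a *: p]addr0 hermPl herm0l addr0. Qed.

Lemma herm_suml k I (s : seq I) (F : I -> {mpoly C[n]}) q :
  herm k (\sum_(i <- s) F i) q = \sum_(i <- s) herm k (F i) q.
Proof.
elim: s => [|i s IH]; first by rewrite !big_nil herm0l.
by rewrite !big_cons hermDl IH.
Qed.

Lemma hermZr k a p q : herm k p (a *: q) = a^* * herm k p q.
Proof. by rewrite hermC hermZl (rmorphM Num.conj) /= -hermC. Qed.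

Lemma herm_sumr k I (s : seq I) (F : I -> {mpoly C[n]}) p :
  herm k p (\sum_(i <- s) F i) = \sum_(i <- s) herm k p (F i).
Proof.
by rewrite hermC herm_suml rmorph_sum; apply: eq_bigr => i _; rewrite [RHS]hermC.
Qed.

Lemma hermDr k p q q' : herm k p (q + q') = herm k p q + herm k p q'.
Proof.
by rewrite hermC hermDl (rmorphD Num.conj) /= [in RHS]hermC [herm k p q']hermC.
Qed.

Lemma herm_ge0 k p : 0 <= herm k p p.
Proof.
elim: k p => [|k IH] p /=; first exact: mul_conjC_ge0.
by apply: sumr_ge0 => t _; exact: IH.
Qed.

(** Euler's relation, read on the coefficients. *)
Lemma homog_mderiv_eq0 k p :
  p \is k.+1.-homog -> (forall r, p^`M(r) = 0) -> p = 0.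
Proof.
move=> hp dp0; apply/mpolyP => u; rewrite mcoeff0.
have [/eqP|] := eqVneq (mdeg u) k.+1; last exact: dhomog_nemf_coeff.
move=> du; have /eqP := du; case: (pickP (fun r => u r != 0%N)) => [r ur|u0].
  move=> _; have := congr1 (mcoeff (u - U_(r))%MM) (dp0 r).
  rewrite mcoeff_mderiv mcoeff0 submK ?mnm1_le //; last first.
    by apply/mnm_lepP => j; rewrite mnm1E; case: eqP => // <-; rewrite lt0n.
  by move/eqP; rewrite mulrn_eq0 /= => /eqP.
suff -> : u = 0%MM by rewrite mdeg0.
by apply/mnmP => r; have := u0 r; rewrite mnm0E => /negbFE /eqP.
Qed.

(** Positivity on forms of degree [k] follows by induction on [k] from the
    fact that a form of positive degree is determined by its gradient. *)
Lemma herm_definite k p :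
  row_full L -> p \is k.-homog -> herm k p p = 0 -> p = 0.
Proof.
move=> /row_fullP[B BL]; elim: k p => [|k IH] p hp /=.
  move/eqP; rewrite mul_conjC_eq0 => /eqP p0.
  apply/mpolyP => u; rewrite mcoeff0.
  have [u0|/eqP] := eqVneq (mdeg u) 0%N; last by move/eqP; exact: dhomog_nemf_coeff.
  by move/eqP: u0; rewrite mdeg_eq0 => /eqP ->.
move/eqP; rewrite psumr_eq0 => [/allP dL0|t _]; last exact: herm_ge0.
have {}dL0 t : ddir (row t L) p = 0.
  apply: IH; last by apply/eqP; apply: dL0; rewrite mem_index_enum.
  by apply: rpred_sum => r _; rewrite rpredZ //; exact: mderiv_homog hp.
apply: (homog_mderiv_eq0 hp) => r.
have -> : p^`M(r) = \sum_(t < m) B r t *: ddir (row t L) p.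
  rewrite /ddir; under eq_bigr => t _ do rewrite scaler_sumr.
  rewrite exchange_big /= (bigD1 r) //= [X in _ + X]big1 => [|s sr].
    rewrite addr0; under eq_bigr => t _ do rewrite scalerA mxE.
    rewrite -scaler_suml; have := congr1 (fun A : 'M_n => A r r) BL.
    by rewrite !mxE eqxx => ->; rewrite scale1r.
  under eq_bigr => t _ do rewrite scalerA mxE.
  rewrite -scaler_suml; have := congr1 (fun A : 'M_n => A r s) BL.
  by rewrite !mxE eq_sym (negbTE sr) => ->; rewrite scale0r.
by rewrite big1 // => t _; rewrite dL0 scaler0.
Qed.

Definition gram : 'M[C]_n := L^T *m map_mx Num.conj L.

Lemma herm_ddir k (A B : 'M[C]_(m, n)) p q :
  \sum_(t < m) herm k (ddir (row t A) p) (ddir (row t B) q) =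
  \sum_(i < n) \sum_(j < n)
    (A^T *m map_mx Num.conj B) i j * herm k p^`M(i) q^`M(j).
Proof.
under eq_bigr => t _ do rewrite /ddir herm_suml.
rewrite exchange_big; apply: eq_bigr => i _ /=.
under eq_bigr => t _ do rewrite herm_sumr.
rewrite exchange_big; apply: eq_bigr => j _ /=.
rewrite mxE mulr_suml; apply: eq_bigr => t _.
by rewrite hermZl hermZr !mxE mulrA.
Qed.

(** The commutator of a directional derivative with a linear vector field is
    again a directional derivative, so adjointness in degree one, which is the
    hypothesis, propagates to all degrees. *)
Lemma herm_der k M N p q : M *m gram = gram *m (map_mx Num.conj N)^T ->
  herm k (der M p) q = herm k p (der N q).
Proof.
move=> adj; have row0 A p' : (der A p')@_0%MM = 0.
  rewrite /der raddf_sum big1 // => r _; rewrite /= (rmorphM (mcoeff 0%MM)).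
  rewrite [X in X * _](_ : _ = 0) ?mul0r // /linear_form raddf_sum big1 // => s _.
  by rewrite /= mcoeffZ mcoeffX mnm1_eq0 mulr0.
elim: k p q => [|k IH] p q /=; first by rewrite !row0 mul0r rmorph0 mulr0.
have dd A t p' : ddir (row t L) (der A p') =
    der A (ddir (row t L) p') + ddir (row t (L *m A^T)) p'.
  rewrite /ddir raddf_sum /=; under eq_bigr => r _ do
    rewrite mderiv_der scalerDr -(linearZZ (der A)).
  rewrite big_split /=; congr (_ + _).
  rewrite /ddir; under eq_bigr => i _ do rewrite scaler_sumr.
  rewrite exchange_big; apply: eq_bigr => r _ /=.
  by rewrite !mxE scaler_suml; apply: eq_bigr => i _; rewrite !mxE scalerA.
under eq_bigr => t _ do rewrite dd hermDl IH.
under [RHS]eq_bigr => t _ do rewrite dd hermDr.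
rewrite !big_split /=; congr (_ + _); rewrite !herm_ddir.
apply: eq_bigr => i _; apply: eq_bigr => j _; congr (_ * _).
by rewrite trmx_mul trmxK -mulmxA -/gram adj /gram -mulmxA map_mxM map_trmx.
Qed.

End HermitianForm.

(** * Integer tables for the action on the 26-dimensional module *)

Notation ivec := (seq int).

Definition vec (l : ivec) : 'rV[int]_6 := \row_(i < 6) l`_i.
Definition ladd (a b : ivec) : ivec := [seq x.1 + x.2 | x <- zip a b].
Definition lopp (a : ivec) : ivec := [seq - x | x <- a].
Definition lsig (a : ivec) : ivec := [:: a`_5; a`_1; a`_4; a`_3; a`_2; a`_0].

Definition lform (a b : ivec) : int :=
  2 * (a`_0 * b`_0 + a`_1 * b`_1 + a`_2 * b`_2
       + a`_3 * b`_3 + a`_4 * b`_4 + a`_5 * b`_5)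
  - (a`_0 * b`_2 + a`_2 * b`_0) - (a`_2 * b`_3 + a`_3 * b`_2)
  - (a`_3 * b`_4 + a`_4 * b`_3) - (a`_4 * b`_5 + a`_5 * b`_4)
  - (a`_1 * b`_3 + a`_3 * b`_1).

Definition lsign (a b : ivec) : int :=
  if odd `|a`_0 * b`_0 + a`_1 * b`_1 + a`_2 * b`_2 + a`_3 * b`_3 + a`_4 * b`_4
     + a`_5 * b`_5 + a`_0 * b`_2 + a`_3 * b`_1 + a`_2 * b`_3 + a`_4 * b`_3
     + a`_5 * b`_4| then -1 else 1.

Definition norm1 (a : ivec) : nat := sumn [seq `|x|%N | x <- a].

Definition short_roots : seq ivec :=
  [:: [:: 1; 1; 2; 2; 1; 1]; [:: 1; 1; 2; 2; 1; 0]; [:: 1; 1; 1; 2; 1; 0];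
      [:: 1; 1; 1; 1; 1; 0]; [:: 1; 1; 1; 1; 0; 0]; [:: 1; 0; 1; 1; 1; 0];
      [:: 0; 1; 1; 1; 0; 0]; [:: 1; 0; 1; 1; 0; 0]; [:: 0; 0; 1; 1; 0; 0];
      [:: 1; 0; 1; 0; 0; 0]; [:: 0; 0; 1; 0; 0; 0]; [:: 1; 0; 0; 0; 0; 0]].

(** The positive roots fixed by the diagram automorphism, which do not
    contribute to the module. *)
Definition fixed_roots : seq ivec :=
  [:: [:: 1; 2; 2; 3; 2; 1]; [:: 1; 1; 2; 3; 2; 1]; [:: 1; 1; 2; 2; 2; 1];
      [:: 1; 1; 1; 2; 1; 1]; [:: 1; 1; 1; 1; 1; 1]; [:: 0; 1; 1; 2; 1; 0];
      [:: 1; 0; 1; 1; 1; 1]; [:: 0; 1; 1; 1; 1; 0]; [:: 0; 0; 1; 1; 1; 0];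
      [:: 0; 1; 0; 1; 0; 0]; [:: 0; 0; 0; 1; 0; 0]; [:: 0; 1; 0; 0; 0; 0]].

Definition roots : seq ivec :=
  let pos := short_roots ++ map lsig short_roots ++ fixed_roots in
  pos ++ map lopp pos.

Definition simple (i : nat) : ivec := [seq (j == i)%:Z | j <- iota 0 6].
Definition simples : seq ivec := map simple (iota 0 6).
Definition signed_simples : seq ivec := simples ++ map lopp simples.

(** The weight of the r-th basis vector, counted from zero. The two vectors in
    the Cartan subalgebra, in positions 12 and 13, have weight zero. *)
Definition weights : seq ivec :=
  short_roots ++ nseq 2 (nseq 6 0) ++ rev (map lopp short_roots).

Notation sform := (seq (nat * int)).
Notation table := (seq sform).

Definition sscale (c : int) (l : sform) : sform := [seq (x.1, c * x.2) | x <- l].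

(** The coordinates of [E_b - E_(sigma b)] on the basis vectors. The index 12
    has to be excluded since it is the first occurrence of the zero weight. *)
Definition root_form (b : ivec) : sform :=
  let i := index b weights in
  if (i < 26)%N && (i != 12) then [:: (i, 1)] else
  let j := index (lsig b) weights in
  if (j < 26)%N && (j != 12) then [:: (j, -1)] else [::].

(** The coordinates of [[E_a, E_b] - [E_(sigma a), E_(sigma b)]]. *)
Definition bracket_form (a b : ivec) : sform :=
  if b == lopp a then [:: (12%N, a`_5 - a`_0); (13%N, a`_4 - a`_2)]
  else sscale (lsign a b) (root_form (ladd a b)).

(** The image of the r-th basis vector under [E_a + E_(sigma a)]. As the diagram
    automorphism preserves brackets, the four brackets of root vectors group
    into two antisymmetrized ones. *)
Definition action_row (a : ivec) (r : nat) : sform :=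
  if r == 12 then sscale (- lform [:: 1; 0; 0; 0; 0; -1] a) (root_form a)
  else if r == 13 then sscale (- lform [:: 0; 0; 1; 0; -1; 0] a) (root_form a)
  else let b := nth [::] weights r in bracket_form a b ++ bracket_form (lsig a) b.

Definition root_table (a : ivec) : table := mkseq (action_row a) 26.

Definition cartan_table (h : ivec) : table :=
  mkseq (fun r => [:: (r, lform h (nth [::] weights r))]) 26.

Definition coef (l : sform) (s : nat) : int :=
  foldr (fun x acc => (if x.1 == s then x.2 else 0) + acc) 0 l.

Definition table_mul (t u : table) : table :=
  [seq flatten [seq sscale x.2 (nth [::] u x.1) | x <- l] | l <- t].
Definition table_scale (c : int) (t : table) : table := map (sscale c) t.
Definition table_add (t u : table) : table :=
  mkseq (fun i => nth [::] t i ++ nth [::] u i) 26.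
Definition table_tr (t : table) : table :=
  mkseq (fun i => mkseq (fun j => (j, coef (nth [::] t j) i)) 26) 26.
Definition table_eq (t u : table) : bool :=
  all (fun i => all (fun j => coef (nth [::] t i) j == coef (nth [::] u i) j)
    (iota 0 26)) (iota 0 26).

Definition table_comm (t u : table) : table :=
  table_add (table_mul u t) (table_scale (-1) (table_mul t u)).

Definition raise_table i := root_table (simple i).
Definition lower_table i := root_table (lopp (simple i)).
Definition coroot i := ladd (simple i) (lsig (simple i)).
Definition coroot_table i := cartan_table (coroot i).

(** A signed simple root whose subtraction brings [a] closer to zero. *)
Definition pivot (a : ivec) : ivec :=
  let dec s := (lform a s == 1) && (norm1 (ladd a (lopp s)) < norm1 a)%N in
  nth [::] signed_simples (find dec signed_simples).

(** The commutator of the root vectors attached to [s] and [b], for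
    [a = s + b], is the one attached to [a], up to the nonzero factor [c]; a
    fixed [s] or [b] counts twice, because [E_s + E_(sigma s)] is then
    [2 E_s]. *)
Definition step_ok (a : ivec) : bool :=
  if a \in signed_simples then true else
  let s := pivot a in let b := ladd a (lopp s) in
  let c := lsign s b * (if (lsig s == s) || (lsig b == b) then 2 else 1) in
  [&& s \in signed_simples, b \in roots, (norm1 b < norm1 a)%N &
    table_eq (table_comm (root_table s) (root_table b)) (table_scale c (root_table a))].

Lemma root_steps : all step_ok roots.
Proof. by vm_compute. Qed.

Lemma comm_raise_lower_table : all (fun i => all (fun j =>
    let c := if lsig (simple i) == simple i then -2 else -1 in
    let d := if (i == j) || (lsig (simple i) == simple j) then c else 0 in
    table_eq (table_comm (raise_table i) (lower_table j)) (table_scale d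
      (coroot_table i)))
  (iota 0 6)) (iota 0 6).
Proof. by vm_compute. Qed.

Lemma comm_coroot_lower_table : all (fun i => all (fun j =>
    table_eq (table_comm (coroot_table i) (lower_table j))
      (table_scale (- lform (coroot i) (simple j)) (lower_table j)))
  (iota 0 6)) (iota 0 6).
Proof. by vm_compute. Qed.

Lemma roots_saturated : all (fun b => all (fun s =>
    let a := ladd b s in (lform a a == 2) ==> (a \in roots))
  signed_simples) roots.
Proof. by vm_compute. Qed.

(** The Gram matrix of the basis vectors for the compact form of the algebra,
    up to a factor 2: the two vectors in the Cartan subalgebra are not
    orthogonal. *)
Definition gram_table : table :=
  mkseq (fun r => if r == 12 then [:: (12%N, 2); (13%N, -1)]
    else if r == 13 then [:: (12%N, -1); (13%N, 2)] else [:: (r, 1)]) 26.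

(** The symmetric matrix of twice the Laplacian. *)
Definition lap_table : table :=
  mkseq (fun r => if r == 12 then [:: (12%N, -2); (13%N, 1)]
    else if r == 13 then [:: (12%N, 1); (13%N, -2)]
    else [:: ((25 - r)%N, 1)]) 26.

Lemma raise_table_gram : all (fun i =>
    table_eq (table_mul (raise_table i) gram_table) (table_scale (-1) (table_mul
      gram_table (table_tr (lower_table i)))))
  (iota 0 6).
Proof. by vm_compute. Qed.

Lemma coroot_table_gram : all (fun i =>
    table_eq (table_mul (coroot_table i) gram_table) (table_scale 1 (table_mul
      gram_table (table_tr (coroot_table i)))))
  (iota 0 6).
Proof. by vm_compute. Qed.

Lemma raise_table_lap : all (fun i =>
    table_eq (table_mul (raise_table i) lap_table) (table_scale (-1) (table_mul
      lap_table (table_tr (raise_table i)))))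
  (iota 0 6).
Proof. by vm_compute. Qed.

Lemma lower_table_lap : all (fun i =>
    table_eq (table_mul (lower_table i) lap_table) (table_scale (-1) (table_mul
      lap_table (table_tr (lower_table i)))))
  (iota 0 6).
Proof. by vm_compute. Qed.

Section TableMatrix.
Variable C : fieldType.

Definition table_mx (t : table) : 'M[C]_26 :=
  \matrix_(i, j) (coef (nth [::] t i) j)%:~R.

Lemma coef_cat l l' s : coef (l ++ l') s = coef l s + coef l' s.
Proof. by elim: l => [|x l /= ->]; rewrite ?add0r ?addrA. Qed.

Lemma coef_scale c l s : coef (sscale c l) s = c * coef l s.
Proof.
by elim: l => [|x l /= ->]; rewrite ?mulr0 //= mulrDr; case: eqP; rewrite ?mulr0.
Qed.

(** The indices from 26 on belong to no variable and contribute zero. *)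
Lemma sum_coef (V : lmodType C) (l : sform) (F : 'I_26 -> V) :
  \sum_(s < 26) (coef l s)%:~R *: F s =
  \sum_(x <- l) x.2%:~R *: (if insub x.1 is Some s then F s else 0).
Proof.
elim: l => [|[r c] l IH] /=.
  by rewrite big_nil big1 // => s _; rewrite scale0r.
rewrite big_cons -IH /=; under eq_bigr => s _ do rewrite rmorphD scalerDl.
rewrite big_split /=; congr (_ + _); case: insubP => [s _ <- | r26].
  rewrite (bigD1 s) //= eqxx big1 ?addr0 // => i si.
  by rewrite eq_sym (inj_eq val_inj) (negbTE si) scale0r.
rewrite scaler0 big1 // => s _; case: eqP => [rs|]; last by rewrite scale0r.
by rewrite rs ltn_ord in r26.
Qed.

Lemma table_mx_scale c t : table_mx (table_scale c t) = c%:~R *: table_mx t.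
Proof.
apply/matrixP => i j; rewrite !mxE -rmorphM /= -coef_scale.
have [it|it] := ltnP i (size t); first by rewrite (nth_map [::]).
by rewrite !nth_default ?size_map.
Qed.

Lemma table_mx_add t u : table_mx (table_add t u) = table_mx t + table_mx u.
Proof. by apply/matrixP => i j; rewrite !mxE -rmorphD /= -coef_cat nth_mkseq. Qed.

Lemma table_mx_tr t : table_mx (table_tr t) = (table_mx t)^T.
Proof.
apply/matrixP => i j; rewrite !mxE nth_mkseq //; congr (_%:~R).
rewrite /mkseq; set f := (X in map X _).
have cf s r : uniq s -> coef [seq f k | k <- s] r =
    if r \in s then coef (nth [::] t r) i else 0.
  elim: s => //= k s IH /andP[ks us]; rewrite IH // in_cons.
  rewrite [r == k]eq_sym; case: eqP => [<-|_] /=; last by rewrite add0r.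
  by rewrite (negbTE ks) addr0.
by rewrite cf ?iota_uniq // mem_iota ltn_ord.
Qed.

Lemma table_mx_mul t u : (size u <= 26)%N ->
  table_mx (table_mul t u) = table_mx t *m table_mx u.
Proof.
move=> u26; apply/matrixP => i j; rewrite !mxE.
under eq_bigr => s _ do rewrite !mxE.
rewrite (@sum_coef C^o _ (fun s => (coef (nth [::] u s) j)%:~R)).
have -> : nth [::] (table_mul t u) i =
    flatten [seq sscale x.2 (nth [::] u x.1) | x <- nth [::] t i].
  have [it|it] := ltnP i (size t); first by rewrite (nth_map [::]).
  by rewrite !nth_default ?size_map.
elim: (nth [::] t i) => [|x l IH] /=; first by rewrite big_nil.
rewrite big_cons coef_cat coef_scale rmorphD rmorphM /= IH; congr (_ + _).
case: insubP => [s _ <- //|]; rewrite -leqNgt => x26.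
by rewrite nth_default ?(leq_trans u26) // rmorph0 scaler0 mulr0.
Qed.

Lemma table_mx_eq t u : table_eq t u -> table_mx t = table_mx u.
Proof.
move=> /allP tu; apply/matrixP => i j; rewrite !mxE; congr (_%:~R).
have /tu/allP tui : (i : nat) \in iota 0 26 by rewrite mem_iota /=.
by apply/eqP/tui; rewrite mem_iota /=.
Qed.

Lemma table_mx_comm t u : (size t <= 26)%N -> (size u <= 26)%N ->
  table_mx (table_comm t u) = table_mx u *m table_mx t - table_mx t *m table_mx u.
Proof.
by move=> st su; rewrite table_mx_add table_mx_scale !table_mx_mul // rmorphN1 scaleN1r.
Qed.

Lemma der_table (t : table) (r : 'I_26) :
  der (table_mx t) 'X_r = \sum_(x <- nth [::] t r)
     x.2%:~R *: (if insub x.1 is Some s then 'X_s else 0).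
Proof.
rewrite derX /linear_form -sum_coef; apply: eq_bigr => s _.
by rewrite !mxE.
Qed.

End TableMatrix.

(** * The root system of type E_6 in integer coordinates *)

Section IntegerVectors.

Lemma co_vec a i : (0 < i < 7)%N -> co (vec a) i = a`_i.-1.
Proof. by case: i => // i /= i7; rewrite /co mxE inordK. Qed.

Definition coords (k : 'rV[int]_6) : ivec := mkseq (fun i => k 0 (inord i)) 6.

Lemma size_coords k : size (coords k) = 6. Proof. by rewrite size_mkseq. Qed.

Lemma coordsK k : vec (coords k) = k.
Proof. by apply/rowP => i; rewrite mxE nth_mkseq // inord_val. Qed.

Lemma vecK a : size a = 6 -> coords (vec a) = a.
Proof.
move=> a6; apply: (@eq_from_nth _ 0); rewrite size_coords // => i i6.
by rewrite nth_mkseq // mxE inordK.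
Qed.

Lemma vec_inj a b : size a = 6 -> size b = 6 -> (vec a == vec b) = (a == b).
Proof.
move=> a6 b6; apply/eqP/eqP => [ab|-> //].
by rewrite -(vecK a6) ab vecK.
Qed.

Lemma vec_add a b : size a = 6 -> size b = 6 -> vec (ladd a b) = vec a + vec b.
Proof.
move=> a6 b6; apply/rowP => i; rewrite !mxE.
by rewrite (nth_map (0, 0)) ?size_zip ?a6 ?b6 // nth_zip ?a6 ?b6.
Qed.

Lemma vec_opp a : size a = 6 -> vec (lopp a) = - vec a.
Proof. by move=> a6; apply/rowP => i; rewrite !mxE (nth_map 0) ?a6. Qed.

Lemma vec_sig a : vec (lsig a) = sigma (vec a).
Proof. by rewrite /sigma !co_vec. Qed.

Lemma size_ladd a b : size a = 6 -> size b = 6 -> size (ladd a b) = 6.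
Proof. by move=> a6 b6; rewrite size_map size_zip a6 b6. Qed.

Lemma E6_form_vec (C : comNzRingType) a b :
  E6_form (map_mx intr (vec a) : 'rV[C]_6) (map_mx intr (vec b)) =
  (lform a b)%:~R.
Proof.
have coC i l : co (map_mx intr (vec l) : 'rV[C]_6) i = (co (vec l) i)%:~R.
  by rewrite /co mxE.
rewrite /E6_form /E6_gram /E6_adj unlock /= !coC !co_vec //= /lform.
rewrite !addr0 -!(rmorphM, rmorphD) /=; congr (_%:~R); ring.
Qed.

Lemma E6_form_vec_int a b : E6_form (vec a) (vec b) = lform a b.
Proof.
have := E6_form_vec int a b; rewrite intz => <-.
by congr E6_form; apply/rowP => i; rewrite !mxE intz.
Qed.

Lemma is_root_vec a : is_root (vec a) = (lform a a == 2).
Proof. by rewrite /is_root E6_form_vec_int. Qed.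

Lemma sign_oddz (C : fieldType) (z : int) : (-1) ^ z = (-1) ^+ odd `|z| :> C.
Proof.
case: z => n; first by rewrite -exprnP signr_odd.
by rewrite NegzE -exprz_inv invrN1 -exprnP abszN signr_odd.
Qed.

Lemma E6_sign_vec (C : fieldType) a b :
  E6_sign C (vec a) (vec b) = (lsign a b)%:~R.
Proof.
rewrite /E6_sign sign_oddz unlock /= !co_vec //= /lsign.
rewrite [X in odd `|X|](_ : _ = a`_0 * b`_0 + a`_1 * b`_1 + a`_2 * b`_2
     + a`_3 * b`_3 + a`_4 * b`_4
     + a`_5 * b`_5 + a`_0 * b`_2 + a`_3 * b`_1 + a`_2 * b`_3 + a`_4 * b`_3
     + a`_5 * b`_4); last by ring.
by case: odd; rewrite ?expr1 ?expr0 ?rmorphN1 ?rmorph1.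
Qed.

Lemma size_signed_simple s : s \in signed_simples -> size s = 6.
Proof.
have /allP h : all (fun s => size s == 6) signed_simples by vm_compute.
by move/h/eqP.
Qed.

Lemma lform_ladd2 a b : size a = 6 -> size b = 6 ->
  lform (ladd a b) (ladd a b) = lform a a + lform b b + 2 * lform a b.
Proof.
move=> a6 b6.
have E i : (i < 6)%N -> (ladd a b)`_i = a`_i + b`_i.
  by move=> i6; rewrite (nth_map (0, 0)) ?size_zip ?a6 ?b6 // nth_zip ?a6 ?b6.
rewrite /lform !E //.
ring.
Qed.

(** Completing squares along the three branches of the Dynkin diagram, from the
    leaves to the central node. *)
Lemma lform_sos (y1 y2 y3 y4 y5 y6 : int) :
  12 * lform [:: y1; y2; y3; y4; y5; y6] [:: y1; y2; y3; y4; y5; y6] =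
      6 * (2 * y1 - y3) ^+ 2 + 2 * (3 * y3 - 2 * y4) ^+ 2
      + 6 * (2 * y6 - y5) ^+ 2 + 2 * (3 * y5 - 2 * y4) ^+ 2
      + 6 * (2 * y2 - y4) ^+ 2 + 2 * y4 ^+ 2.
Proof. rewrite /lform /=. ring. Qed.

Lemma lform_def a : size a = 6 -> a != nseq 6 0 -> 0 < lform a a.
Proof.
case: a => [|y1 [|y2 [|y3 [|y4 [|y5 [|y6 [|? ?]]]]]]] // _ b0.
have := lform_sos y1 y2 y3 y4 y5 y6.
set q := lform _ _ => sos.
have sq (x : int) : 0 <= x ^+ 2 by exact: sqr_ge0.
have sq0 (x : int) : x ^+ 2 <= 0 -> x = 0.
  by move=> x0; apply/eqP; rewrite -sqrf_eq0 eq_le x0 sq.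
have /= := (sq (2 * y1 - y3), sq (3 * y3 - 2 * y4), sq (2 * y6 - y5)).
have /= := (sq (3 * y5 - 2 * y4), sq (2 * y2 - y4), sq y4).
rewrite ltNge; move: sos; case: (leP q 0) => //= q0.
have := (sq0 (2 * y1 - y3), sq0 (3 * y3 - 2 * y4), sq0 (2 * y6 - y5)).
have := (sq0 (3 * y5 - 2 * y4), sq0 (2 * y2 - y4), sq0 y4).
move: ((2 * y1 - y3) ^+ 2) ((3 * y3 - 2 * y4) ^+ 2) ((2 * y6 - y5) ^+ 2).
move: ((3 * y5 - 2 * y4) ^+ 2) ((2 * y2 - y4) ^+ 2) (y4 ^+ 2).
move=> s1 s2 s3 s4 s5 s6 [[z1 z2] z3] [[z4 z5] z6] sos [[? ?] ?] [[? ?] ?].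
have {}z1 := z1 ltac:(lra).
have {}z2 := z2 ltac:(lra).
have {}z3 := z3 ltac:(lra).
have {}z4 := z4 ltac:(lra).
have {}z5 := z5 ltac:(lra).
have {}z6 := z6 ltac:(lra).
case/eqP: b0; clear -z1 z2 z3 z4 z5 z6.
by congr [:: _; _; _; _; _; _]; lra.
Qed.

(** The numbers [a`_i * lform a (simple i)] add up to [lform a a], hence one of
    them is positive; the sign of [a`_i] says which of the two signed simple
    roots to subtract. *)
Lemma root_descent a : size a = 6 -> lform a a = 2 ->
  exists2 s, s \in signed_simples &
    0 < lform a s /\ (norm1 (ladd a (lopp s)) < norm1 a)%N.
Proof.
case: a => [|x1 [|x2 [|x3 [|x4 [|x5 [|x6 [|? ?]]]]]]] // _.
set a := [:: _; _; _; _; _; _] => a2.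
have sumE : lform a a = x1 * lform a (simple 0) + x2 * lform a (simple 1)
  + x3 * lform a (simple 2) + x4 * lform a (simple 3) + x5 * lform a (simple 4)
  + x6 * lform a (simple 5) by rewrite /lform /=; ring.
apply: contrapT => no.
have {}no s : s \in signed_simples -> 0 < lform a s ->
    (norm1 a <= norm1 (ladd a (lopp s)))%N.
  by move=> ss as1; rewrite leqNgt; apply/negP => lt; apply: no; exists s.
have neg s : lform a (lopp (simple s)) = - lform a (simple s).
  by rewrite /lform !(nth_map 0) ?size_map //=; ring.
have le0 (i : nat) : (i < 6)%N -> a`_i * lform a (simple i) <= 0.
  move=> i6; have si : simple i \in signed_simples.
    by rewrite mem_cat map_f // mem_iota.
  have si' : lopp (simple i) \in signed_simples.
    by rewrite mem_cat orbC !map_f // mem_iota.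
  have := no _ si; have := no _ si'; rewrite neg.
  move: (lform a _) => c; rewrite /norm1 /a.
  have pos2 (x : int) : 0 < x * c -> (0 < x) && (0 < c) || (x < 0) && (c < 0).
    case: (ltrgt0P x) => [x0|x0|->]; last by rewrite mul0r ltxx.
      by rewrite pmulr_rgt0 // => ->.
    by rewrite nmulr_rgt0.
  case: i i6 {si si'} => [|[|[|[|[|[|//]]]]]] _ /= h1 h2; rewrite leNgt;
    by apply/negP => /pos2/orP[] /andP[]; lia.
have := (le0 0%N isT, le0 1%N isT, le0 2%N isT).
have := (le0 3%N isT, le0 4%N isT, le0 5%N isT).
by move: sumE; rewrite a2 /= => sumE [[? ?] ?] [[? ?] ?]; lra.
Qed.

Lemma lform_oppr a s : size s = 6 -> lform a (lopp s) = - lform a s.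
Proof. by move=> s6; rewrite /lform !(nth_map 0) ?s6 //=; ring. Qed.

Lemma lform_opp s : size s = 6 -> lform (lopp s) (lopp s) = lform s s.
Proof. by move=> s6; rewrite /lform !(nth_map 0) ?s6 //=; ring. Qed.

Lemma laddNK a s : size a = 6 -> size s = 6 -> ladd (ladd a (lopp s)) s = a.
Proof.
move=> a6 s6; have n6 : size (lopp s) = 6 by rewrite size_map.
have b6 := size_ladd a6 n6.
rewrite -[RHS]vecK // -[LHS]vecK ?size_ladd //; congr coords.
by rewrite !vec_add // vec_opp // subrK.
Qed.

(** By descent: subtracting from the root [a] the signed simple root of
    [root_descent] yields a shorter vector which, the form being even and
    positive definite, is zero or a root again. The explicit list is closed
    under the reverse operation. *)
Lemma roots_complete a : size a = 6 -> lform a a = 2 -> a \in roots.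
Proof.
have [n] := ubnP (norm1 a); elim: n a => // n IH a lt_n a6 a2.
have [s ss [as1 ltb]] := root_descent a6 a2.
have s6 := size_signed_simple ss; have n6 : size (lopp s) = 6 by rewrite size_map.
have b6 := size_ladd a6 n6.
have /allP/(_ _ ss)/andP[s2 sr] : all (fun s =>
  (lform s s == 2) && (s \in roots)) signed_simples by vm_compute.
have bb := lform_ladd2 a6 n6; rewrite lform_opp // lform_oppr // (eqP s2) a2 in bb.
have abs := laddNK a6 s6.
have [b0|b0] := eqVneq (ladd a (lopp s)) (nseq 6 0).
  suff -> : a = s by [].
  rewrite -abs b0 -[RHS](vecK s6) -[LHS]vecK ?size_ladd ?size_nseq //; congr coords.
  by rewrite vec_add ?size_nseq //; apply/rowP => i;
    rewrite !mxE nth_nseq ltn_ord add0r.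
have b2 := lform_def b6 b0.
have br : ladd a (lopp s) \in roots.
  by apply: IH => //; [exact: leq_trans ltb _|lia].
have /allP/(_ _ br)/allP/(_ _ ss) := roots_saturated.
by cbv zeta; rewrite abs a2 eqxx.
Qed.

End IntegerVectors.

(** * The bracket on root vectors and on the Cartan subalgebra *)

Section F4Action.
Variable C : fieldType.
Local Notation rv a := (root_vec C (vec a)).

Lemma sum_root (V : lmodType C) (F : E6_root -> V) (G : lattice -> V) a :
  is_root a -> (forall r : E6_root, F r = (root_val r == a)%:R *: G (root_val r)) ->
  \sum_r F r = G a.
Proof.
move=> ra FG; rewrite (bigD1 (E6Root ra)) //= FG eqxx scale1r big1 ?addr0 // => r.
by rewrite FG -(inj_eq val_inj) /= => /negbTE ->; rewrite scale0r.
Qed.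

Lemma E6_formDl (k k' l : 'rV[C]_6) c :
  E6_form (c *: k + k') l = c * E6_form k l + E6_form k' l.
Proof.
rewrite /E6_form mulr_sumr -big_split; apply: eq_bigr => i _ /=.
rewrite mulr_sumr -big_split; apply: eq_bigr => j _ /=.
by rewrite /co !mxE; ring.
Qed.

Let regroup (V : zmodType) (a a' b b' d d' : V) :
  a + a' - (b + b') + (d + d') = a - b + d + (a' - b' + d').
Proof. by rewrite opprD (addrACA a) (addrACA (a - b)). Qed.

Lemma bracketDl c (u u' v : lieE6 C) :
  bracket (c *: u + u') v = c *: bracket u v + bracket u' v.
Proof.
rewrite /bracket [c *: (_ + _)]scalerDr [c *: (_ - _)]scalerBr.
have -> : \sum_(b : E6_root) (v.2 b * E6_form (c *: u + u').1 (lattice_in_H C b)) *: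
  root_vec C b
  = c *: (\sum_(b : E6_root) (v.2 b * E6_form u.1 (lattice_in_H C b)) *: root_vec C b)
  + \sum_(b : E6_root) (v.2 b * E6_form u'.1 (lattice_in_H C b)) *: root_vec C b.
  rewrite scaler_sumr -big_split; apply: eq_bigr => b _ /=.
  by rewrite E6_formDl scalerA -scalerDl; congr (_ *: _); ring.
have -> : \sum_(a : E6_root) ((c *: u + u').2 a * E6_form v.1 (lattice_in_H C a)) *:
  root_vec C a
  = c *: (\sum_(a : E6_root) (u.2 a * E6_form v.1 (lattice_in_H C a)) *: root_vec C a)
  + \sum_(a : E6_root) (u'.2 a * E6_form v.1 (lattice_in_H C a)) *: root_vec C a.
  rewrite scaler_sumr -big_split; apply: eq_bigr => b _ /=.
  rewrite scalerA -scalerDl; congr (_ *: _); rewrite !ffunE /= mulrDl mulrA.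
  by [].
have -> : \sum_(a : E6_root) \sum_(b :
  E6_root) ((c *: u + u').2 a * v.2 b) *: root_bracket C a b
  = c *: (\sum_(a : E6_root) \sum_(b : E6_root) (u.2 a * v.2 b) *: root_bracket C a b)
  + \sum_(a : E6_root) \sum_(b : E6_root) (u'.2 a * v.2 b) *: root_bracket C a b.
  rewrite scaler_sumr -big_split; apply: eq_bigr => a _ /=.
  rewrite scaler_sumr -big_split; apply: eq_bigr => b _ /=.
  rewrite scalerA -scalerDl; congr (_ *: _); rewrite !ffunE /= mulrDl mulrA.
  by [].
exact: regroup.
Qed.

Lemma bracketDr c (u v v' : lieE6 C) :
  bracket u (c *: v + v') = c *: bracket u v + bracket u v'.
Proof.
rewrite /bracket [c *: (_ + _)]scalerDr [c *: (_ - _)]scalerBr.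
have -> : \sum_(b : E6_root) ((c *: v + v').2 b * E6_form u.1 (lattice_in_H C b)) *:
  root_vec C b
  = c *: (\sum_(b : E6_root) (v.2 b * E6_form u.1 (lattice_in_H C b)) *: root_vec C b)
  + \sum_(b : E6_root) (v'.2 b * E6_form u.1 (lattice_in_H C b)) *: root_vec C b.
  rewrite scaler_sumr -big_split; apply: eq_bigr => b _ /=.
  by rewrite scalerA -scalerDl; congr (_ *: _); rewrite !ffunE /= mulrDl mulrA.
have -> : \sum_(a : E6_root) (u.2 a * E6_form (c *: v + v').1 (lattice_in_H C a)) *:
  root_vec C a
  = c *: (\sum_(a : E6_root) (u.2 a * E6_form v.1 (lattice_in_H C a)) *: root_vec C a)
  + \sum_(a : E6_root) (u.2 a * E6_form v'.1 (lattice_in_H C a)) *: root_vec C a.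
  rewrite scaler_sumr -big_split; apply: eq_bigr => b _ /=.
  by rewrite E6_formDl scalerA -scalerDl; congr (_ *: _); ring.
have -> : \sum_(a : E6_root) \sum_(b :
  E6_root) (u.2 a * (c *: v + v').2 b) *: root_bracket C a b
  = c *: (\sum_(a : E6_root) \sum_(b : E6_root) (u.2 a * v.2 b) *: root_bracket C a b)
  + \sum_(a : E6_root) \sum_(b : E6_root) (u.2 a * v'.2 b) *: root_bracket C a b.
  rewrite scaler_sumr -big_split; apply: eq_bigr => a _ /=.
  rewrite scaler_sumr -big_split; apply: eq_bigr => b _ /=.
  rewrite scalerA -scalerDl; congr (_ *: _); rewrite !ffunE /= mulrDr.
  by rewrite mulrCA.
exact: regroup.
Qed.

Lemma E6_form0 (l : 'rV[C]_6) : E6_form 0 l = 0.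
Proof.
rewrite /E6_form big1 // => i _; rewrite big1 // => j _.
by rewrite /co mxE !mul0r.
Qed.

Lemma bracket_root_root a b : is_root a -> is_root b ->
  bracket (root_vec C a) (root_vec C b) = root_bracket C a b.
Proof.
move=> ra rb; rewrite /bracket /= big1 => [|r _];
  last by rewrite E6_form0 mulr0 scale0r.
rewrite big1 => [|r _]; last by rewrite E6_form0 mulr0 scale0r.
rewrite subrr add0r (sum_root (G := root_bracket C ^~ b) ra) // => r.
rewrite -(sum_root (F := fun s => ((root_val r == a)%:R * (root_val s == b)%:R) *:
   root_bracket C r s) (G := fun s => (root_val r == a)%:R *: root_bracket C r s) rb)
     //.
  by apply: eq_bigr => s _; rewrite !ffunE.
by move=> s; rewrite scalerA mulrC.
Qed.

Lemma bracket_cartan_root h b : is_root b ->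
  bracket (cartan_vec h) (root_vec C b) = E6_form h (lattice_in_H C b) *: root_vec C b.
Proof.
move=> rb; rewrite /bracket /= (sum_root
   (G := fun b => E6_form h (lattice_in_H C b) *: root_vec C b) rb); last first.
  by move=> s; rewrite !ffunE scalerA.
rewrite big1 => [|r _]; last by rewrite ffunE mul0r scale0r.
rewrite big1 => [|r _]; last by rewrite big1 // => s _; rewrite ffunE mul0r scale0r.
by rewrite subr0 addr0.
Qed.

Lemma bracket_root_cartan h a : is_root a ->
  bracket (root_vec C a) (cartan_vec h) =
    - E6_form h (lattice_in_H C a) *: root_vec C a.
Proof.
move=> ra; rewrite /bracket /= big1 => [|r _]; last by rewrite ffunE mul0r scale0r.
rewrite (sum_root
   (G := fun b => E6_form h (lattice_in_H C b) *: root_vec C b) ra); last first.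
  by move=> s; rewrite !ffunE scalerA.
rewrite big1 => [|r _]; last by rewrite big1 // => s _; rewrite !ffunE mulr0 scale0r.
by rewrite add0r addr0 scaleNr.
Qed.

Lemma bracket_cartan_cartan (h h' : 'rV[C]_6) :
  bracket (cartan_vec h) (cartan_vec h') = 0.
Proof.
rewrite /bracket /= big1 => [|r _]; last by rewrite ffunE mul0r scale0r.
rewrite big1 => [|r _]; last by rewrite ffunE mul0r scale0r.
rewrite big1 => [|r _]; last by rewrite big1 // => s _; rewrite !ffunE mulr0 scale0r.
by rewrite subr0 addr0.
Qed.

End F4Action.

(** * The tables compute the action *)

Section F4Representation.
Variable C : fieldType.
Local Notation rv a := (root_vec C (vec a)).

Definition vec_of_form (l : sform) : lieE6 C := \sum_(x <- l) x.2%:~R *: xvec C x.1.+1.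

Lemma vec_of_form_cat l l' : vec_of_form (l ++ l') = vec_of_form l + vec_of_form l'.
Proof. by rewrite /vec_of_form big_cat. Qed.

Lemma vec_of_form_scale c l : vec_of_form (sscale c l) = c%:~R *: vec_of_form l.
Proof.
rewrite /vec_of_form big_map scaler_sumr; apply: eq_bigr => x _ /=.
by rewrite scalerA rmorphM.
Qed.

Lemma size_weight r : (r < 26)%N -> size (nth [::] weights r) = 6.
Proof.
move=> r26; have /allP h : all (fun b => size b == 6) weights by vm_compute.
by apply/eqP/h/mem_nth.
Qed.

Lemma xvec_short r : (r < 26)%N -> r != 12 -> r != 13 ->
  xvec C r.+1 = rv (nth [::] weights r) - rv (lsig (nth [::] weights r)).
Proof.
have bE : betas = map vec short_roots by [].
move=> r26 r12 r13; rewrite /xvec /beta bE /weights.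
have [r_lt|r_ge] := leqP r.+1 12.
  by rewrite (nth_map [::]) // nth_cat r_lt vec_sig.
rewrite !eqSS (negbTE r12) (negbTE r13).
have i12 : ((27 - r.+1).-1 < size short_roots)%N by rewrite /=; lia.
rewrite nth_cat ifN -?leqNgt // nth_cat size_nseq ifN; last by rewrite /=; lia.
rewrite nth_rev ?size_map; last by rewrite /=; lia.
have -> : (size short_roots - (r - size short_roots - 2).+1 =
  (27 - r.+1).-1)%N by rewrite /=; lia.
rewrite !(nth_map [::]) // -vec_sig.
have /allP h : all (fun a => (size a == 6) && (lsig (lopp a) == lopp (lsig a)))
   short_roots by vm_compute.
have /andP[/eqP s6 /eqP ->] := h _ (mem_nth [::] i12).
by rewrite !vec_opp.
Qed.

(** A root outside the list of weights, up to the diagram automorphism, is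
    fixed by the latter, and then both sides vanish. *)
Lemma root_formP b : size b = 6 -> lform b b = 2 ->
  rv b - rv (lsig b) = vec_of_form (root_form b).
Proof.
move=> b6 b2; have br := roots_complete b6 b2.
have /allP/(_ _ br) : all (fun b =>
   let i := index b weights in let j := index (lsig b) weights in
   (lsig (lsig b) == b) && if (i < 26)%N && (i != 12) then (i != 13) else
   if (j < 26)%N && (j != 12) then (j != 13) else (lsig b == b)) roots.
  by vm_compute.
rewrite /root_form; set i := index b weights; set j := index (lsig b) weights.
case/andP=> /eqP bb; case: ifP => [/andP[i26 i12] i13|_].
  rewrite /vec_of_form big_seq1 scale1r xvec_short //.
  by rewrite nth_index // -index_mem.
case: ifP => [/andP[j26 j12] j13|_ /eqP ->]; last by rewrite subrr /vec_of_form big_nil.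
rewrite /vec_of_form big_seq1 rmorphN1 scaleN1r xvec_short //.
by rewrite nth_index -?index_mem // bb opprB.
Qed.

Lemma root_form_nonroot b : size b = 6 -> lform b b != 2 -> root_form b = [::].
Proof.
move=> b6 b2; have /allP h : all (fun b => (index b weights == 12) ||
   (lform b b == 2) && (lform (lsig b) (lsig b) == 2)) weights by vm_compute.
rewrite /root_form; case: ifP => [/andP[]|_].
  rewrite -[26%N]/(size weights) index_mem => /h /orP[->//|].
  by rewrite (negbTE b2).
case: ifP => // /andP[]; rewrite -[26%N]/(size weights) index_mem => /h /orP[->//|].
have -> : lsig (lsig b) = b by case: b b6 {b2} => [|? [|? [|? [|? [|? [|? []]]]]]].
by rewrite (negbTE b2) andbF.
Qed.

Lemma lsigK b : size b = 6 -> lsig (lsig b) = b.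
Proof. by case: b => [|? [|? [|? [|? [|? [|? []]]]]]]. Qed.

Lemma lsig_form a b : lform (lsig a) (lsig b) = lform a b.
Proof. by rewrite /lform /=; ring. Qed.

Lemma lsig_sign a b : lsign (lsig a) (lsig b) = lsign a b.
Proof. by rewrite /lsign /=; congr (if odd `|_| then _ else _); ring. Qed.

Lemma lsig_add a b : size a = 6 -> size b = 6 ->
  ladd (lsig a) (lsig b) = lsig (ladd a b).
Proof.
by case: a => [|? [|? [|? [|? [|? [|? []]]]]]] // _;
  case: b => [|? [|? [|? [|? [|? [|? []]]]]]].
Qed.

Lemma cartanB (h h' : 'rV[C]_6) :
  cartan_vec h - cartan_vec h' = cartan_vec (h - h').
Proof. by apply: (f_equal2 pair); rewrite // subr0. Qed.

Lemma cartanZ c (h : 'rV[C]_6) : c *: cartan_vec h = cartan_vec (c *: h).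
Proof. by apply: (f_equal2 pair); rewrite // scaler0. Qed.

Lemma cartanD (h h' : 'rV[C]_6) :
  cartan_vec h + cartan_vec h' = cartan_vec (h + h').
Proof. by apply: (f_equal2 pair); rewrite // addr0. Qed.

(** The sign cocycle and the form are invariant under the diagram automorphism,
    so both root brackets fall in the same case of their definition. *)
Lemma bracket_formP a b : size a = 6 -> size b = 6 ->
  lform a a = 2 -> lform b b = 2 ->
  root_bracket C (vec a) (vec b) - root_bracket C (vec (lsig a)) (vec (lsig b))
    = vec_of_form (bracket_form a b).
Proof.
move=> a6 b6 a2 b2; have n6 : size (lopp a) = 6 by rewrite size_map.
rewrite /root_bracket -!vec_opp // !vec_inj // ?size_map // -!vec_add //.
have -> : (lsig b == lopp (lsig a)) = (b == lopp a).
  have -> : lopp (lsig a) = lsig (lopp a).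
    by case: a a6 {a2 n6} => [|? [|? [|? [|? [|? [|? []]]]]]].
  by apply/eqP/eqP => [/(congr1 lsig)|->//]; rewrite !lsigK.
rewrite /bracket_form; case: eqP => [_|_].
  rewrite /vec_of_form big_cons big_seq1 /xvec /= cartanB !cartanZ cartanD.
  congr cartan_vec; apply/rowP => i; rewrite !mxE;
    case: i => [[|[|[|[|[|[|//]]]]]] i6] /=; rewrite ?rmorphB /=; ring.
rewrite !is_root_vec lsig_add // lsig_form !E6_sign_vec lsig_sign.
case: eqP => [ab2|/eqP ab2].
  by rewrite -scalerBr vec_of_form_scale root_formP ?size_ladd.
by rewrite root_form_nonroot ?size_ladd // /vec_of_form big_nil subrr.
Qed.

Lemma weight_root r : (r < 26)%N -> r != 12 -> r != 13 ->
  lform (nth [::] weights r) (nth [::] weights r) = 2.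
Proof.
have /allP h : all (fun r => [|| r == 12, r == 13 |
  lform (nth [::] weights r) (nth [::] weights r) == 2]) (iota 0 26) by vm_compute.
move=> r26; have := h r; rewrite mem_iota /= => /(_ r26).
by case: eqP => //= _; case: eqP => //= _ /eqP.
Qed.

Lemma bracketBr (u v v' : lieE6 C) :
  bracket u (v - v') = bracket u v - bracket u v'.
Proof. by rewrite addrC -scaleN1r bracketDr scaleN1r addrC. Qed.

Let regroup4 (V : zmodType) (x y z t : V) : x - y + (z - t) = x - t + (z - y).
Proof. by rewrite addrACA [RHS]addrACA [- y + _]addrC. Qed.

Lemma bracket_table a r : size a = 6 -> lform a a = 2 -> (r < 26)%N ->
  bracket (rv a + rv (lsig a)) (xvec C r.+1) = vec_of_form (action_row a r).
Proof.
move=> a6 a2 r26; have ra : is_root (vec a) by rewrite is_root_vec a2.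
have rs : is_root (vec (lsig a)) by rewrite is_root_vec lsig_form a2.
have Dl (u u' v : lieE6 C) : bracket (u + u') v = bracket u v + bracket u' v.
  by rewrite -[u]scale1r bracketDl !scale1r.
have cartan_case h : size h = 6 -> lsig h = lopp h ->
    bracket (rv a + rv (lsig a)) (cartan_vec (map_mx intr (vec h))) =
    vec_of_form (sscale (- lform h a) (root_form a)).
  move=> h6 hs; rewrite Dl !bracket_root_cartan // /lattice_in_H !E6_form_vec.
  have -> : lform h (lsig a) = - lform h a.
    by rewrite -lsig_form lsigK // hs /lform !(nth_map 0) ?h6 //; ring.
  rewrite vec_of_form_scale -root_formP // !rmorphN /= scalerBr opprK.
  by rewrite [X in _ = _ - X]scaleNr opprK.
have x13 : xvec C 13 = cartan_vec (map_mx intr (vec [:: 1; 0; 0; 0; 0; -1])).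
  rewrite /xvec /=; congr cartan_vec; apply/rowP => i; rewrite !mxE.
  by case: i => [[|[|[|[|[|[|//]]]]]] i6]; rewrite /= ?rmorph0 ?rmorphN1.
have x14 : xvec C 14 = cartan_vec (map_mx intr (vec [:: 0; 0; 1; 0; -1; 0])).
  rewrite /xvec /=; congr cartan_vec; apply/rowP => i; rewrite !mxE.
  by case: i => [[|[|[|[|[|[|//]]]]]] i6]; rewrite /= ?rmorph0 ?rmorphN1.
rewrite /action_row; case: eqP => [->|r12]; first by rewrite x13; apply: cartan_case.
case: eqP => [->|r13]; first by rewrite x14; apply: cartan_case.
have bil (u u' v v' : lieE6 C) : bracket (u + u') (v - v') =
    bracket u v - bracket u' v' + (bracket u' v - bracket u v').
  by rewrite Dl (bracketBr u) (bracketBr u'); apply: regroup4.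
move/eqP: r12 => r12; move/eqP: r13 => r13.
rewrite xvec_short // vec_of_form_cat.
move: (nth [::] weights r) (size_weight r26) (weight_root r26 r12 r13) => b b6 b2.
have rb : is_root (vec b) by rewrite is_root_vec b2.
have rbs : is_root (vec (lsig b)) by rewrite is_root_vec lsig_form b2.
have h1 := bracket_formP a6 b6 a2 b2.
have a2' : lform (lsig a) (lsig a) = 2 by rewrite lsig_form.
have h2 := @bracket_formP (lsig a) b erefl b6 a2' b2; rewrite (lsigK a6) in h2.
apply: etrans (bil _ _ _ _) _.
rewrite (bracket_root_root C ra rb) (bracket_root_root C ra rbs).
rewrite (bracket_root_root C rs rb) (bracket_root_root C rs rbs).
exact: (f_equal2 +%R h1 h2).
Qed.

Lemma xbasis_nth (r : 'I_26) : (xbasis C)`_r = xvec C r.+1.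
Proof. by rewrite -tnth_nth tnth_mktuple. Qed.

Definition xcoord (j : nat) (u : lieE6 C) : C :=
  if j == 12 then co u.1 1 else if j == 13 then co u.1 3 else
  \sum_(r : E6_root) (root_val r == vec (nth [::] weights j))%:R * u.2 r.

Lemma xcoord_lin j c u u' : xcoord j (c *: u + u') = c * xcoord j u + xcoord j u'.
Proof.
rewrite /xcoord; case: eqP => _; first by rewrite /co !mxE.
case: eqP => _; first by rewrite /co !mxE.
rewrite mulr_sumr -big_split; apply: eq_bigr => r _ /=.
by rewrite !ffunE mulrDr mulrCA.
Qed.

Lemma xcoord_root (j : nat) b : j != 12 -> j != 13 -> size b = 6 ->
  (j < 26)%N -> xcoord j (rv b) = (nth [::] weights j == b)%:R.
Proof.
move=> j12 j13 b6 j26; rewrite /xcoord (negbTE j12) (negbTE j13).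
have rj : is_root (vec (nth [::] weights j)) by rewrite is_root_vec weight_root.
rewrite -(vec_inj (size_weight j26) b6) /=.
rewrite (@sum_root C C^o _ (fun a : lattice => (a == vec b)%:R) _ rj) // => r.
by rewrite ffunE.
Qed.

Lemma xcoord_root0 (j : nat) b : (j == 12) || (j == 13) -> xcoord j (rv b) = 0.
Proof.
by rewrite /xcoord => /orP[] /eqP ->; rewrite /co /= mxE.
Qed.

Lemma xcoord_cartan (j : nat) h : j != 12 -> j != 13 -> xcoord j (cartan_vec h) = 0.
Proof.
move=> j12 j13; rewrite /xcoord (negbTE j12) (negbTE j13).
by rewrite big1 // => r _; rewrite ffunE mulr0.
Qed.

Lemma xcoordP (i j : nat) : (i < 26)%N -> (j < 26)%N ->
  xcoord j (xvec C i.+1) = (i == j)%:R.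
Proof.
move=> i26 j26; have [i12|i12] := eqVneq i 12.
  rewrite i12; have [->|j12] := eqVneq j 12; first by rewrite /xcoord /co /= mxE inordK.
  have [->|j13] := eqVneq j 13; first by rewrite /xcoord /co /= mxE inordK.
  by rewrite xcoord_cartan // eq_sym (negbTE j12).
have [i13|i13] := eqVneq i 13.
  rewrite i13; have [->|j12] := eqVneq j 12; first by rewrite /xcoord /co /= mxE inordK.
  have [->|j13] := eqVneq j 13; first by rewrite /xcoord /co /= mxE inordK.
  by rewrite xcoord_cartan // eq_sym (negbTE j13).
rewrite xvec_short // addrC -scaleN1r xcoord_lin.
have [jh|] := boolP ((j == 12) || (j == 13)).
  rewrite !xcoord_root0 // mulr0 addr0; case: eqP => // ij.
  by case/orP: jh => /eqP j1; rewrite ij j1 eqxx in i12 i13.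
rewrite negb_or => /andP[j12 j13].
rewrite !xcoord_root ?size_weight //.
have /allP/(_ i)/(_ _)/allP/(_ j) : all (fun i => all (fun j =>
    [|| i == 12, i == 13, j == 12, j == 13 |
     ((nth [::] weights j == nth [::] weights i) == (i == j)) &&
     (nth [::] weights j != lsig (nth [::] weights i))]) (iota 0 26)) (iota 0 26).
  by vm_compute.
rewrite !mem_iota => /(_ i26 j26).
rewrite (negbTE i12) (negbTE i13) (negbTE j12) (negbTE j13).
by case/andP=> /eqP -> /negbTE ->; rewrite mulr0 add0r.
Qed.

Lemma xvec_free : free (xbasis C).
Proof.
apply/freeP => k k0 j.
have x0 : xcoord j 0 = 0.
  apply: (addrI (xcoord j 0)); rewrite addr0.
  by have := xcoord_lin j 1 0 0; rewrite scaler0 addr0 mul1r => <-.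
have : xcoord j (\sum_(i < 26) k i *: (xbasis C)`_i) =
    \sum_(i < 26) k i * xcoord j (xbasis C)`_i.
  apply: (big_ind2 (fun u c => xcoord j u = c)) => // [u c v d uc vd|i _].
    by rewrite -[u]scale1r xcoord_lin uc vd mul1r.
  by rewrite -[k i *: _]addr0 xcoord_lin x0 addr0.
rewrite k0 x0 (bigD1 j) //= big1 ?addr0 => [|i ij].
  by rewrite xbasis_nth xcoordP // eqxx mulr1 => <-.
by rewrite xbasis_nth xcoordP // (inj_eq val_inj) (negbTE ij) mulr0.
Qed.

Definition bounded (l : sform) := all (fun x => x.1 < 26)%N l.

Lemma coord_vec_of_form l (s : 'I_26) : bounded l ->
  coord (xbasis C) s (vec_of_form l) = (coef l s)%:~R.
Proof.
rewrite /vec_of_form raddf_sum; elim: l => [|x l IH] /=; first by rewrite big_nil.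
case/andP=> x26 /IH {}IH; rewrite big_cons IH rmorphD /=; congr (_ + _).
rewrite linearZ /= -[x.1]/(nat_of_ord (Ordinal x26)) -xbasis_nth coord_free
  ?xvec_free //.
by rewrite /= -(inj_eq val_inj) /=; case: (_ == _); rewrite ?mulr1 ?mulr0.
Qed.

Lemma bounded_scale c l : bounded (sscale c l) = bounded l.
Proof. by rewrite /bounded all_map. Qed.

Lemma bounded_root_form b : bounded (root_form b).
Proof.
rewrite /root_form; case: ifP => [/andP[h _]|_]; first by rewrite /= h.
by case: ifP => [/andP[h _]|_] //; rewrite /= h.
Qed.

Lemma bounded_action_row a r : bounded (action_row a r).
Proof.
have bh a' b : bounded (bracket_form a' b).
  by rewrite /bracket_form; case: ifP => // _; rewrite bounded_scale bounded_root_form.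
rewrite /action_row; case: eqP => _; first by rewrite bounded_scale bounded_root_form.
case: eqP => _; first by rewrite bounded_scale bounded_root_form.
by rewrite /bounded all_cat; apply/andP; split; exact: bh.
Qed.

Definition adV (g : lieE6 C) : 'M[C]_26 :=
  \matrix_(r, s) coord (xbasis C) s (bracket g (tnth (xbasis C) r)).

Lemma act_der g p : act g p = der (adV g) p.
Proof.
apply: eq_bigr => r _; congr (_ * _); apply: eq_bigr => s _.
by rewrite !mxE.
Qed.

Definition root_elt (a : ivec) : lieE6 C := rv a + rv (lsig a).
Definition cartan_elt (h : ivec) : lieE6 C := cartan_vec (map_mx intr (vec h)).

Lemma adV_root a : a \in roots -> adV (root_elt a) = table_mx C (root_table a).
Proof.
move=> ar; have /allP/(_ _ ar)/andP[/eqP a6 /eqP a2] :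
  all (fun a => (size a == 6) && (lform a a == 2)) roots by vm_compute.
apply/matrixP => r s; rewrite !mxE tnth_mktuple bracket_table // coord_vec_of_form.
  by rewrite nth_mkseq.
exact: bounded_action_row.
Qed.

Lemma adV_cartan h : lsig h = h -> adV (cartan_elt h) = table_mx C (cartan_table h).
Proof.
move=> hs; apply/matrixP => r s; rewrite !mxE tnth_mktuple nth_mkseq //.
suff -> : bracket (cartan_elt h) (xvec C r.+1) =
    vec_of_form [:: (r : nat, lform h (nth [::] weights r))].
  by rewrite coord_vec_of_form // /bounded /= ltn_ord.
have [r12|r12] := eqVneq (r : nat) 12.
  rewrite r12 bracket_cartan_cartan /vec_of_form big_seq1.
  by rewrite /lform /= !(mulr0, addr0, subr0) scale0r.
have [r13|r13] := eqVneq (r : nat) 13.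
  rewrite r13 bracket_cartan_cartan /vec_of_form big_seq1.
  by rewrite /lform /= !(mulr0, addr0, subr0) scale0r.
rewrite /vec_of_form big_seq1 xvec_short // bracketBr.
have b2 := weight_root (ltn_ord r) r12 r13.
set b := nth _ _ _ in b2 *.
rewrite !bracket_cartan_root ?is_root_vec ?lsig_form ?b2 // /lattice_in_H.
have hb : lform h (lsig b) = lform h b.
  by rewrite -[LHS]lsig_form hs lsigK // size_weight.
by rewrite !E6_form_vec hb scalerBr.
Qed.

End F4Representation.

(** * Submodules and Chevalley generators *)

Section SubmoduleCriterion.
Variable C : numClosedFieldType.
Local Notation rv a := (root_vec C (vec a)).

Lemma sigma_hat_root a : is_root (vec a) -> sigma_hat (rv a) = rv (lsig a).
Proof.
move=> ra; rewrite /sigma_hat (sum_root (G := fun b => root_vec C (sigma b)) ra);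
  last first.
  by move=> r; rewrite ffunE.
rewrite vec_sig; suff -> : sigma (0 : 'rV[C]_6) = 0 by rewrite add0r.
by apply/rowP => i; rewrite !mxE; case: i => [[|[|[|[|[|[|//]]]]]] i6];
  rewrite /= /co mxE.
Qed.

Lemma sigma_hatD u v : sigma_hat (u + v) = sigma_hat u + sigma_hat v :> lieE6 C.
Proof.
rewrite /sigma_hat [RHS]addrACA cartanD; congr (_ + _).
  by congr cartan_vec; apply/rowP => i; rewrite !mxE;
    case: i => [[|[|[|[|[|[|//]]]]]] i6]; rewrite /= /co mxE.
rewrite -big_split; apply: eq_bigr => r _ /=.
by rewrite ffunE scalerDl.
Qed.

Lemma root_eltF4 a : a \in roots -> root_elt C a \in lieF4 C.
Proof.
move=> ar; have /allP/(_ _ ar)/andP[/eqP a6 /eqP a2] :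
  all (fun a => (size a == 6) && (lform a a == 2)) roots by vm_compute.
rewrite inE /root_elt sigma_hatD !sigma_hat_root ?is_root_vec ?lsig_form ?a2 //.
by rewrite lsigK // addrC.
Qed.

Lemma lieE6_split (g : lieE6 C) :
  g = cartan_vec g.1 + \sum_(a : E6_root) g.2 a *: root_vec C a.
Proof.
case: g => h e /=; apply: (f_equal2 pair).
  rewrite (raddf_sum (@fst _ _)) big1 ?addr0 // => a _ /=.
  by rewrite scaler0.
rewrite (raddf_sum (@snd _ _)) add0r; apply/ffunP => r.
rewrite sum_ffunE (bigD1 r) //= !ffunE eqxx big1 ?addr0 => [|a ar].
  by rewrite [_ *: _]mulr1.
by rewrite !ffunE (inj_eq val_inj) eq_sym (negbTE ar) scaler0.
Qed.

(** An invariant element is the average of itself and its image under the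
    diagram automorphism. *)
Lemma lieF4_span (g : lieE6 C) : g \in lieF4 C ->
  2 *: g = \sum_(i < 6) g.1 0 i *: cartan_elt C (coroot i)
     + \sum_(a : E6_root) g.2 a *: root_elt C (coords a).
Proof.
rewrite inE => /eqP gs; rewrite scaler_nat mulr2n -{2}gs {1}[g]lieE6_split /sigma_hat.
rewrite addrACA cartanD; congr (_ + _); last first.
  rewrite -big_split; apply: eq_bigr => a _ /=.
  by rewrite /root_elt scalerDr vec_sig coordsK.
rewrite /cartan_elt; under eq_bigr => i _ do rewrite cartanZ.
have -> (F : 'I_6 -> 'rV[C]_6) :
  \sum_(i < 6) cartan_vec (F i) = cartan_vec (\sum_(i < 6) F i).
  symmetry; apply: (big_morph (@cartan_vec C)) => [u v|]; first by rewrite cartanD.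
  by [].
congr cartan_vec; apply/rowP => j; rewrite summxE.
have -> : \sum_(i < 6) (g.1 0 i *: (map_mx intr (vec (coroot i)) : 'rV[C]_6)) 0 j
   = \sum_(0 <= i < 6) g.1 0 (inord i) * ((coroot i)`_j)%:~R.
  by rewrite big_mkord; apply: eq_bigr => i _; rewrite !mxE inord_val.
rewrite unlock /= !mxE /co /=; have -> : g.1 0 j = g.1 0 (inord j) by rewrite inord_val.
by case: j => [[|[|[|[|[|[|//]]]]]] j6]; rewrite /=; ring.
Qed.

Variable k : nat.
Local Notation P := (polyA C k).

Definition homog_der (M : 'M[C]_26) (f : P) : P := DHomog (der_homog M (valP f)).

Lemma homog_der_is_linear M : linear (homog_der M).
Proof. by move=> a p q; apply: val_inj; rewrite /= linearP. Qed.
HB.instance Definition _ M :=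
  GRing.isLinear.Build C _ _ _ (homog_der M) (homog_der_is_linear M).

Definition stable (W : {vspace P}) (M : 'M[C]_26) : Prop :=
  forall f, f \in W -> homog_der M f \in W.

Lemma stableD W M N : stable W M -> stable W N -> stable W (M + N).
Proof.
move=> hM hN f fW; have -> : homog_der (M + N) f = homog_der M f + homog_der N f.
  by apply: val_inj; rewrite /= derD.
by rewrite memvD ?hM ?hN.
Qed.

Lemma homog_derZ c M f : homog_der (c *: M) f = c *: homog_der M f.
Proof. by apply: val_inj; rewrite /= derZ. Qed.

Lemma stableZ W c M : stable W M -> stable W (c *: M).
Proof. by move=> hM f fW; rewrite homog_derZ memvZ ?hM. Qed.

Lemma stable_scale W c M : c != 0 -> stable W (c *: M) -> stable W M.
Proof. by move=> c0 /(stableZ c^-1); rewrite scalerA mulVf // scale1r. Qed.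

Lemma stable_sum W I (s : seq I) (F : I -> 'M[C]_26) :
  (forall i, stable W (F i)) -> stable W (\sum_(i <- s) F i).
Proof.
move=> hF; apply: big_ind => // [|M N]; last exact: stableD.
by rewrite -(scale0r 0) => f fW; rewrite homog_derZ scale0r mem0v.
Qed.

Lemma homog_der_comm M N f :
  homog_der (N *m M - M *m N) f = homog_der M (homog_der N f)
    - homog_der N (homog_der M f).
Proof. by apply: val_inj; rewrite /= der_comm. Qed.

Lemma stable_comm W M N :
  stable W M -> stable W N -> stable W (N *m M - M *m N).
Proof.
by move=> hM hN f fW; rewrite homog_der_comm; apply: memvB; [apply/hM/hN|apply/hN/hM].
Qed.

Lemma signed_simpleP (s : ivec) : s \in signed_simples ->
  exists2 i, (i < 6)%N & s = simple i \/ s = lopp (simple i).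
Proof.
have /allP h : all (fun s => has (fun i => (s == simple i) || (s == lopp (simple i)))
  (iota 0 6)) signed_simples by vm_compute.
by move=> /h/hasP[i i6] /orP[]/eqP ->; exists i; rewrite ?mem_iota // in i6 *;
  [left|right].
Qed.

Lemma size_root_table a : (size (root_table a) <= 26)%N.
Proof. by rewrite size_mkseq. Qed.

Lemma size_cartan_table h : (size (cartan_table h) <= 26)%N.
Proof. by rewrite size_mkseq. Qed.

(** Indices range over all six simple roots of E_6; those in one orbit of the
    diagram automorphism give the same operators. *)
Definition chevalley_stable W :=
  forall i, (i < 6)%N -> stable W (table_mx C (raise_table i)) /\
    stable W (table_mx C (lower_table i)).

(** Induction on the length of the root, by [root_steps]. *)
Lemma stable_root W (a : ivec) : chevalley_stable W -> a \in roots ->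
  stable W (table_mx C (root_table a)).
Proof.
move=> gW; have gs (s : ivec) : s \in signed_simples ->
  stable W (table_mx C (root_table s)).
  case/signed_simpleP => i i6 [->|->].
    by have [he _] := gW i i6; exact: he.
  by have [_ hf] := gW i i6; exact: hf.
have [n] := ubnP (norm1 a); elim: n a => // n IH a lt_n ar.
have /allP/(_ _ ar) := root_steps; rewrite /step_ok; case: ifP => [/gs //|_].
move: (pivot a) => s; cbv zeta; set b := ladd _ _; set c := (_ * _).
have c0 : c != 0 by rewrite /c /lsign; case: odd; case: ifP.
case/and4P=> /gs ss br ltb /(table_mx_eq C).
rewrite (table_mx_comm C (size_root_table _) (size_root_table _)) table_mx_scale => E.
apply: (@stable_scale _ c%:~R); first by rewrite intr_eq0.
rewrite -E; apply: stable_comm; first exact: ss.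
by apply: IH; [exact: leq_trans ltb _|exact: br].
Qed.

Lemma comm_raise_lower i j : (i < 6)%N -> (j < 6)%N -> exists2 d : int,
  table_mx C (lower_table j) *m table_mx C (raise_table i)
    - table_mx C (raise_table i) *m table_mx C (lower_table j)
    = d%:~R *: table_mx C (coroot_table i) & (i == j -> d != 0).
Proof.
move=> i6 j6; have /allP/(_ i)/(_ _)/allP/(_ j) := comm_raise_lower_table.
rewrite !mem_iota => /(_ i6 j6); cbv zeta; set d := (if _ then _ else 0).
move/(table_mx_eq C); rewrite (table_mx_comm C (size_root_table _) (size_root_table
  _)) table_mx_scale => E; exists d => //.
by rewrite /d => ->; case: ifP.
Qed.

Lemma comm_coroot_lower i j : (i < 6)%N -> (j < 6)%N -> exists d : int,
  table_mx C (lower_table j) *m table_mx C (coroot_table i)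
    - table_mx C (coroot_table i) *m table_mx C (lower_table j)
    = d%:~R *: table_mx C (lower_table j).
Proof.
move=> i6 j6; have /allP/(_ i)/(_ _)/allP/(_ j) := comm_coroot_lower_table.
rewrite !mem_iota => /(_ i6 j6) /(table_mx_eq C).
by rewrite (table_mx_comm C (size_cartan_table _) (size_root_table _)) table_mx_scale
  => E; eexists; exact: E.
Qed.

Lemma stable_cartan W i : chevalley_stable W -> (i < 6)%N ->
  stable W (table_mx C (coroot_table i)).
Proof.
move=> gW i6; have [d E d0] := comm_raise_lower i6 i6; have [he hf] := gW i i6.
apply: (@stable_scale _ d%:~R); first by rewrite intr_eq0 d0.
by rewrite -E; apply: stable_comm.
Qed.

Lemma adV_lin c (g g' : lieE6 C) : adV (c *: g + g') = c *: adV g + adV g'.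
Proof. by apply/matrixP => r s; rewrite 5!mxE bracketDl; exact: linearP. Qed.

Lemma adV_sum I (s : seq I) (c : I -> C) (F : I -> lieE6 C) :
  adV (\sum_(i <- s) c i *: F i) = \sum_(i <- s) c i *: adV (F i).
Proof.
have a0 : adV (0 : lieE6 C) = 0.
  by apply: (addrI (adV 0)); rewrite addr0 -{1}[adV 0]scale1r -adV_lin scaler0 addr0.
elim: s => [|i s IH]; first by rewrite !big_nil.
by rewrite !big_cons adV_lin IH.
Qed.

Lemma act_homog_der g f : act_homogeneous g f = homog_der (adV g) f.
Proof. by apply: val_inj; rewrite /= act_der. Qed.

Lemma submoduleP W : submodule W <-> chevalley_stable W.
Proof.
split=> [sW i i6|gW g f gF fW].
  have er : simple i \in roots.
    have /allP h : all (fun i => simple i \in roots) (iota 0 6) by vm_compute.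
    by apply: h; rewrite mem_iota.
  have fr : lopp (simple i) \in roots.
    have /allP h : all (fun i => lopp (simple i) \in roots) (iota 0 6) by vm_compute.
    by apply: h; rewrite mem_iota.
  by split=> f fW; [rewrite -(adV_root C er)|rewrite -(adV_root C fr)];
    rewrite -act_homog_der; apply: sW => //; apply: root_eltF4.
rewrite act_homog_der; move: f fW; apply: (@stable_scale W 2);
  first by rewrite pnatr_eq0.
have -> : 2 *: adV g = adV (2 *: g).
  by have := adV_sum [:: tt] (fun _ => 2) (fun _ => g); rewrite !big_seq1.
rewrite (lieF4_span gF) -[X in X + _]scale1r adV_lin scale1r !adV_sum.
apply: stableD; apply: stable_sum => i; apply: stableZ.
  rewrite adV_cartan; first exact: stable_cartan.
  have /allP h : all (fun i => lsig (coroot i) == coroot i) (iota 0 6) by vm_compute.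
  by apply/eqP/h; rewrite mem_iota ltn_ord.
have ir : coords i \in roots.
  apply: roots_complete; first exact: size_coords.
  by apply/eqP; rewrite -is_root_vec coordsK; exact: (valP i).
by rewrite adV_root //; exact: stable_root.
Qed.

End SubmoduleCriterion.

(** * The invariant Hermitian form and complete reducibility *)

Section InvariantForm.
Variables (C : numClosedFieldType) (k : nat).
Local Notation P := (polyA C k).

(** The matrix [1 + u^T u] with [u] the last row is [gram_table], so this frame
    exhibits the positivity of the latter. *)
Definition frame : 'M[C]_(26 + 1, 26) :=
  col_mx 1%:M (\row_(j < 26) ((j == 12 :> nat)%:R - (j == 13 :> nat)%:R)).

Lemma frame_full : row_full frame.
Proof.
by apply/row_fullP; exists (row_mx 1%:M 0); rewrite mul_row_col mul1mx mul0mx addr0.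
Qed.

Lemma frame_gram : gram frame = table_mx C gram_table.
Proof.
rewrite /gram /frame tr_col_mx map_col_mx mul_row_col trmx1 mul1mx map_mx1.
apply/matrixP => i j; rewrite [LHS]mxE [X in _ + X]mxE big_ord1 !mxE nth_mkseq //.
rewrite rmorphB !rmorph_nat -(inj_eq val_inj) /=.
case: i j => [i _] [j _] /=.
have [->|i12] := eqVneq i 12; [|have [->|i13] := eqVneq i 13];
  (have [->|j12] := eqVneq j 12; [|have [->|j13] := eqVneq j 13]);
  rewrite /= ?[12 == j]eq_sym ?[13 == j]eq_sym ?(negbTE i12) ?(negbTE i13)
    ?(negbTE j12) ?(negbTE j13) ?rmorphD /= ?rmorph0 ?rmorphN1; try ring.
by rewrite subrr mul0r; case: eqP => _; rewrite ?rmorph1 ?rmorph0 !addr0.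
Qed.

Lemma map_conj_mx t : map_mx Num.conj (table_mx C t) = table_mx C t.
Proof. by apply/matrixP => i j; rewrite !mxE rmorph_int. Qed.

Definition hform (f g : P) : C := herm frame k (val f) (val g).

Lemma hformC f g : hform g f = (hform f g)^*.
Proof. exact: hermC. Qed.

(** An adjointness relation between tables carries over to all degrees, by
    [herm_der]. *)
Lemma hform_adj (t u : table) (c : int) f g : (size t <= 26)%N -> 
  table_eq (table_mul t gram_table) (table_scale c (table_mul gram_table (table_tr
    u))) ->
  hform (homog_der (table_mx C t) f) g = c%:~R * hform f (homog_der (table_mx C u) g).
Proof.
move=> st /(table_mx_eq C); rewrite table_mx_scale table_mx_mul ?size_mkseq //
  table_mx_mul ?size_mkseq //.
rewrite table_mx_tr => E; rewrite -[in RHS](rmorph_int Num.conj) -hermZr -derZ.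
apply: herm_der; rewrite frame_gram E map_mxZ rmorph_int map_conj_mx.
by rewrite linearZ -scalemxAr.
Qed.

Lemma hform_raise i f g : (i < 6)%N ->
  hform (homog_der (table_mx C (raise_table i)) f) g =
    - hform f (homog_der (table_mx C (lower_table i)) g).
Proof.
move=> i6; rewrite -mulN1r -(rmorphN1 (intmul 1)); apply: hform_adj.
  exact: size_root_table.
have /allP h := raise_table_gram.
by apply: h; rewrite mem_iota.
Qed.

Lemma hform_lower i f g : (i < 6)%N ->
  hform (homog_der (table_mx C (lower_table i)) f) g =
    - hform f (homog_der (table_mx C (raise_table i)) g).
Proof.
by move=> i6; rewrite hformC [in RHS]hformC hform_raise // rmorphN /= opprK.
Qed.

Lemma hform_coroot i f g : (i < 6)%N ->
  hform (homog_der (table_mx C (coroot_table i)) f) g =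
    hform f (homog_der (table_mx C (coroot_table i)) g).
Proof.
move=> i6; rewrite -[RHS]mul1r; apply: (hform_adj (c := 1)).
  exact: size_cartan_table.
have /allP h := coroot_table_gram.
by apply: h; rewrite mem_iota.
Qed.

Lemma hform0 f : hform f f = 0 -> f = 0.
Proof.
by move=> f0; apply: val_inj; apply: herm_definite f0; [exact: frame_full|exact: valP].
Qed.

Definition pairings (W : {vspace P}) (f : P) : 'rV[C]_(\dim W) :=
  \row_j hform f (vbasis W)`_j.

Lemma pairings_is_linear W : linear (pairings W).
Proof. by move=> a f g; apply/rowP => j; rewrite !mxE; exact: hermPl. Qed.
HB.instance Definition _ W :=
  GRing.isLinear.Build C _ _ _ (pairings W) (pairings_is_linear W).

Definition orth (W : {vspace P}) : {vspace P} := lker (linfun (pairings W)).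

Lemma orthP (W : {vspace P}) (f : P) : reflect (forall w, w \in W ->
  hform f w = 0) (f \in orth W).
Proof.
rewrite memv_ker lfunE; apply: (iffP eqP) => [f0 w wW|f0].
  rewrite (coord_vbasis wW) /hform raddf_sum herm_sumr big1 // => j _ /=.
  rewrite hermZr; have := congr1 (fun u : 'rV_(\dim W) => u 0 j) f0.
  by rewrite !mxE /hform => ->; rewrite mulr0.
apply/rowP => j; rewrite !mxE f0 // vbasis_mem // mem_nth //.
by rewrite size_tuple.
Qed.

Lemma orth_cap W : (W :&: orth W = 0)%VS.
Proof.
apply/eqP; rewrite -subv0; apply/subvP => f; rewrite memv_cap => /andP[fW /orthP f0].
by rewrite memv0; apply/eqP/hform0/f0.
Qed.

Lemma orth_add W M : (W <= M)%VS -> (W + (M :&: orth W) = M)%VS.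
Proof.
move=> WM; apply/eqP; rewrite eqEdim subv_add WM capvSl /= dimv_disjoint_sum.
  have := limg_ker_dim (linfun (pairings W)) M; rewrite -/(orth W) => <-.
  rewrite addnC leq_add2r (leq_trans (dimvS (subvf _))) //.
  by rewrite dimvf /dim /= mul1n.
by apply/eqP; rewrite -subv0 -(orth_cap W); apply: capvS => //; exact: capvSr.
Qed.

(** The adjoint of a raising operator is the opposite of a lowering one. *)
Lemma orth_stable W : chevalley_stable W -> chevalley_stable (orth W).
Proof.
move=> gW i i6; have [he hf] := gW i i6.
split=> f /orthP f0; apply/orthP => w wW.
  by rewrite hform_raise // f0 ?oppr0 //; exact: hf.
by rewrite hform_lower // f0 ?oppr0 //; exact: he.
Qed.

Lemma cap_stable (U W : {vspace P}) :
  chevalley_stable U -> chevalley_stable W -> chevalley_stable (U :&: W)%VS.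
Proof.
move=> gU gW i i6; have [ue uf] := gU i i6; have [we wf] := gW i i6.
by split=> f; rewrite !memv_cap => /andP[fU fW]; apply/andP; split;
  [exact: ue|exact: we|exact: uf|exact: wf].
Qed.

(** Complete reducibility: the orthogonal complement of a submodule is again
    a submodule. *)
Lemma decomposition_exists M : chevalley_stable M ->
  exists (n : nat) (W : 'I_n -> {vspace P}), irreducible_decomposition M W.
Proof.
have [d] := ubnP (\dim M); elim: d M => // d IH M lt_d gM.
have [M0|M0] := eqVneq M 0%VS.
  exists 0%N, (fun=> M); split; first by case.
    by rewrite directvE /= !big_ord0 dimv0.
  by rewrite big_ord0.
have [irr|nirr] := EM (forall U : {vspace P}, submodule U -> (U <= M)%VS ->
  U = 0%VS \/ U = M).
  exists 1%N, (fun=> M); split; last by rewrite big_ord1.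
    by move=> _; split=> //; apply/submoduleP.
  by rewrite directvE /= !big_ord1.
have [U [sU UM [U0 UneM]]] : exists U : {vspace P},
    [/\ submodule U, (U <= M)%VS & U <> 0%VS /\ U <> M].
  apply: contrapT => no; apply: nirr => U sU UM.
  by apply: contrapT => /not_orP[? ?]; apply: no; exists U; split.
have gU : chevalley_stable U by apply/submoduleP.
set X := (M :&: orth U)%VS; have gX :
  chevalley_stable X by apply/cap_stable/orth_stable.
have UX0 : (U :&: X = 0)%VS.
  by apply/eqP; rewrite -subv0 -(orth_cap U); apply: capvS => //; exact: capvSr.
have UXM : (U + X = M)%VS := orth_add UM.
have dUX : (\dim U + \dim X = \dim M)%N by rewrite -UXM dimv_disjoint_sum.
have U_gt0 : (0 < \dim U)%N by rewrite lt0n dimv_eq0; apply/eqP.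
have X_gt0 : (0 < \dim X)%N.
  rewrite lt0n dimv_eq0; apply/eqP => X0; apply: UneM.
  by rewrite -UXM X0 addv0.
have [n1 [W1 [i1 d1 s1]]] : exists (n : nat) (W : 'I_n ->
  {vspace P}), irreducible_decomposition U W.
  by apply: IH => //; lia.
have [n2 [W2 [i2 d2 s2]]] : exists (n : nat) (W : 'I_n ->
  {vspace P}), irreducible_decomposition X W.
  by apply: IH => //; lia.
pose W (i : 'I_(n1 + n2)) := match split i with inl j => W1 j | inr j => W2 j end.
have Wl j : W (lshift n2 j) = W1 j by rewrite /W; case: split_ordP => i /eqP;
  rewrite ?eq_shift // => /eqP ->.
have Wr j : W (rshift n1 j) = W2 j by rewrite /W; case: split_ordP => i /eqP;
  rewrite ?eq_shift // => /eqP ->.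
have sumW : (\sum_(i < n1 + n2) W i)%VS = M.
  rewrite big_split_ord /=; under eq_bigr do rewrite Wl.
  by under [X in (_ + X)%VS]eq_bigr do rewrite Wr; rewrite s1 s2.
exists (n1 + n2)%N, W; split=> //.
  by move=> i; rewrite /W; case: (split i) => j; [exact: i1|exact: i2].
move: d1 d2; rewrite !directvE /= s1 s2 sumW => /eqP d1 /eqP d2.
rewrite big_split_ord /=; under eq_bigr do rewrite Wl.
by under [X in (_ + X)%N]eq_bigr do rewrite Wr; rewrite -d1 -d2 dUX.
Qed.

End InvariantForm.

(** * Singular vectors *)

Section SmallestSubspace.
Variables (K : fieldType) (V : vectType K).

(** A subspace of least dimension among those with property [Q]. *)
Lemma smallest_vspace (Q : {vspace V} -> Prop) :
  Q fullv -> (forall U W, Q U -> Q W -> Q (U :&: W)%VS) ->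
  exists2 S, Q S & forall U, Q U -> (S <= U)%VS.
Proof.
move=> Qf QI; pose d n := `[< exists2 U, Q U & \dim U = n >].
have exd : exists n, d n by exists (\dim {:V}); apply/asboolP; exists fullv.
have [m /asboolP[S QS <-] min_S] := ex_minnP exd.
exists S => // U QU; have QSU := QI _ _ QS QU.
have /eqP <- : (S :&: U)%VS == S; last exact: capvSr.
rewrite eqEdim capvSl min_S //; apply/asboolP; by exists (S :&: U)%VS.
Qed.

End SmallestSubspace.

Section SingularVectors.
Variables (C : numClosedFieldType) (k : nat).
Local Notation P := (polyA C k).
Implicit Types (f g : P) (W S : {vspace P}).

Definition singular (f : P) : Prop :=
  forall i, (i < 6)%N -> homog_der (table_mx C (raise_table i)) f = 0.

Definition has_weight (c : nat -> int) (f : P) : Prop :=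
  forall i, (i < 6)%N -> homog_der (table_mx C (coroot_table i)) f = (c i)%:~R *: f.

(** Let [S] be the smallest subspace that contains [w] and is stable under the
    lowering operators. The orthogonal of [w'] contains [w] and is stable under
    the lowering operators, as their adjoints kill [w']; so [S] is orthogonal to
    [w']. The vectors of [S] that a Cartan operator, and then a raising one, maps
    into [S] form again a subspace of this kind, by the Chevalley relations; so
    [S] is a submodule, and meets [W] in [W] itself. *)
Lemma singular_orth (W : {vspace P}) c (w w' : P) : irreducible_submodule W ->
  w \in W -> w' \in W -> singular w -> singular w' -> has_weight c w ->
  hform w w' = 0 -> w != 0 -> w' = 0.
Proof.
move=> [sW _ minW] wW wW' sw sw' cw ww' w0.
pose Q (U : {vspace P}) := w \in U /\ forall i, (i < 6)%N ->
  stable U (table_mx C (lower_table i)).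
have [||S [wS fS] minS] := @smallest_vspace _ _ Q.
- by split=> [|i i6 f _]; exact: memvf.
- move=> U U' [wU fU] [wU' fU']; split=> [|i i6 f]; first by rewrite memv_cap wU.
  rewrite !memv_cap => /andP[fu fu']; apply/andP; split; first exact: fU.
  exact: fU'.
have SY : (S <= orth <[w']>)%VS.
  apply: minS; split=> [|i i6 f /orthP f0]; apply/orthP => v /vlineP[a ->].
    by rewrite /hform hermZr -/(hform w w') ww' mulr0.
  by rewrite hform_lower // linearZ /= sw' // scaler0 /hform hermC herm0l rmorph0 oppr0.
have tS i : (i < 6)%N -> stable S (table_mx C (coroot_table i)).
  move=> i6; set h := linfun (homog_der (table_mx C (coroot_table i)) : P -> P).
  suff SX : (S <= S :&: (h @^-1: S))%VS.
    by move=> f /(subvP SX); rewrite memv_cap -memv_preim lfunE => /andP[].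
  apply: minS; split=> [|j j6 f].
    by rewrite memv_cap wS -memv_preim lfunE /= cw // memvZ.
  rewrite !memv_cap -!memv_preim !lfunE /= => /andP[fs tfs].
  apply/andP; split; first exact: fS.
  have [d /(congr1 (fun M => homog_der M f))] := comm_coroot_lower C i6 j6.
  rewrite homog_der_comm homog_derZ => /eqP; rewrite subr_eq => /eqP ->.
  by apply: memvD; [apply: memvZ|]; exact: fS.
(* here stability under the Cartan operators enters, through the commutator of
   the raising operator with a lowering one *)
have eS i : (i < 6)%N -> stable S (table_mx C (raise_table i)).
  move=> i6; set h := linfun (homog_der (table_mx C (raise_table i)) : P -> P).
  suff SX : (S <= S :&: (h @^-1: S))%VS.
    by move=> f /(subvP SX); rewrite memv_cap -memv_preim lfunE => /andP[].
  apply: minS; split=> [|j j6 f].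
    by rewrite memv_cap wS -memv_preim lfunE /= sw // mem0v.
  rewrite !memv_cap -!memv_preim !lfunE /= => /andP[fs tfs].
  apply/andP; split; first exact: fS.
  have [d /(congr1 (fun M => homog_der M f))] := comm_raise_lower C i6 j6.
  rewrite homog_der_comm homog_derZ => /eqP; rewrite subr_eq => /eqP -> _.
  by apply: memvD; [apply/memvZ/tS|exact: fS].
have gS : chevalley_stable S by move=> i i6; split; [exact: eS|exact: fS].
have gW : chevalley_stable W by apply/submoduleP.
have sSW : submodule (S :&: W)%VS by apply/submoduleP/cap_stable.
have [SW0|SWW] := minW _ sSW (capvSr _ _).
  have : w \in (S :&: W)%VS by rewrite memv_cap wS.
  by rewrite SW0 memv0 (negbTE w0).
have /(subvP SY)/orthP/(_ w' (memv_line w')) : w' \in S.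
  by move: wW'; rewrite -{1}SWW memv_cap => /andP[].
exact: hform0.
Qed.

(** Each component of a singular weight vector is singular of the same weight,
    and two vectors with nonzero components in one summand would contradict
    [singular_orth], because Cartan operators are self-adjoint. *)
Lemma singular_count (M : {vspace P}) (J : finType) (v : J -> P)
    (c : J -> nat -> int) n (W : 'I_n -> {vspace P}) :
  irreducible_decomposition M W ->
  (forall j, v j \in M) -> (forall j, v j != 0) ->
  (forall j, singular (v j)) -> (forall j, has_weight (c j) (v j)) ->
  (forall j j', (forall i, (i < 6)%N -> c j i = c j' i) -> j = j') ->
  (#|J| <= n)%N.
Proof.
move=> [irrW dW sumW] vM v0 sv cv c_inj.
have /all_sig[u uP] j : {u : 'I_n -> P | (forall i, u i \in W i) /\ v j = \sum_i u i}.
  apply: cid; have := vM j; rewrite -sumW => /memv_sumP[u uW vE].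
  by exists u; split=> // i; exact: uW.
have indep (us : 'I_n -> P) : (forall i, us i \in W i) -> \sum_i us i = 0 ->
  forall i, us i = 0.
  by move=> usW us0 i; apply: (directv_sum_independent dW) => // j _.
have su j i : singular (u j i).
  move=> l l6; have [uW vE] := uP j.
  apply: (indep (fun i => homog_der (table_mx C (raise_table l)) (u j i))) => [i'|].
    have [sWi _ _] := irrW i'; have /submoduleP gW := sWi.
    by have [he _] := gW l l6; exact: he.
  by rewrite -raddf_sum /= -vE sv.
have cu j i : has_weight (c j) (u j i).
  move=> l l6; have [uW vE] := uP j; apply/eqP; rewrite -subr_eq0; apply/eqP.
  apply: (indep (fun i => homog_der (table_mx C (coroot_table l)) (u j i)
    - (c j l)%:~R *: u j i)) => [i'|].
    have [sWi _ _] := irrW i'; have /submoduleP gW := sWi.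
    by apply: memvB; [exact: stable_cartan|exact: memvZ].
  by rewrite sumrB -scaler_sumr -raddf_sum /= -vE cv // subrr.
have /all_sig[F FP] j : {i | u j i != 0}.
  apply: cid; apply: contrapT => no; have [_ vE] := uP j.
  move/eqP: (v0 j); apply; rewrite vE big1 // => i _.
  by apply: contrapT => /eqP u0; apply: no; exists i.
suff /leq_card : injective F by rewrite card_ord.
move=> j j' Fjj'; apply: contrapT => jj'.
have [l l6 cl] : exists2 l, (l < 6)%N & c j l != c j' l.
  apply: contrapT => no; apply: jj'; apply: c_inj => l l6.
  by apply: contrapT => /eqP ?; apply: no; exists l.
have uW : u j (F j) \in W (F j) by have [] := uP j.
have uW' : u j' (F j) \in W (F j) by have [] := uP j'.
have := FP j'; rewrite -Fjj' => /eqP; apply.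
apply: (singular_orth (irrW (F j)) uW uW' (su _ _) (su _ _) (cu _ _) _ (FP j)).
apply/eqP; have := hform_coroot (u j (F j)) (u j' (F j)) l6.
rewrite cu // cu // /hform hermZl hermZr rmorph_int => /eqP.
rewrite -subr_eq0 -mulrBl mulf_eq0 -rmorphB /= intr_eq0 subr_eq0 (negbTE cl).
by [].
Qed.

End SingularVectors.

(** * Two singular polynomials *)

Section SingularPolynomials.
Variable C : numClosedFieldType.
Local Notation A := {mpoly C[26]}.
Local Notation x r := ('X_(xvar r) : A).
Implicit Types (p q : A) (M : 'M[C]_26).

Lemma der_var t r : (0 < r < 27)%N -> all bounded t ->
  der (table_mx C t) (x r) = \sum_(y <- nth [::] t r.-1) y.2%:~R *: x y.1.+1.
Proof.
case: r => // r r27 /allP bt; rewrite der_table /xvar /= inordK //.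
have [rt|rt] := ltnP r (size t); last by rewrite nth_default // !big_nil.
have /allP b := bt _ (mem_nth [::] rt).
rewrite big_seq [RHS]big_seq; apply: eq_bigr => y /b y26; congr (_ *: _).
by rewrite insubT /=; congr 'X_(_); apply: val_inj; rewrite /= inordK.
Qed.

(** The component of weight [beta 1] of the equivariant quadratic map from the
    26-dimensional module to itself. *)
Definition zeta1 : A :=
  (x 2 * x 12 + x 3 * x 10 - x 4 * x 8 + x 5 * x 6) *+ 3
  - (x 1 * x 13) *+ 2 - x 1 * x 14.

(** The singular cubic attached to the exterior square of the module: three
    times it is [x_2 q_1 - x_1 q_2], with [q_1 = zeta1] and [q_2] its image under
    the lowering operator that maps [x_1] to [x_2]. *)
Definition zeta2 : A :=
  x 1 * x 1 * x 15 - x 1 * x 2 * x 13 - x 1 * x 3 * x 11 + x 1 * x 4 * x 9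
  - x 1 * x 6 * x 7 + x 2 * x 2 * x 12 + x 2 * x 3 * x 10 - x 2 * x 4 * x 8
  + x 2 * x 5 * x 6.

(** The rows in normal form, so that derivatives of explicit polynomials
    simplify. *)
Definition raising : seq table := Eval vm_compute in map raise_table (iota 0 6).

Lemma raisingE i : (i < 6)%N -> raise_table i = nth [::] raising i.
Proof. by case: i => [|[|[|[|[|[|//]]]]]] _; vm_compute. Qed.

Lemma derDr M p q : der M (p + q) = der M p + der M q. Proof. exact: raddfD. Qed.
Lemma derNr M p : der M (- p) = - der M p. Proof. exact: raddfN. Qed.
Lemma derMn M p n : der M (p *+ n) = der M p *+ n. Proof. exact: raddfMn. Qed.

Lemma zeta_singular i : (i < 6)%N ->
  [/\ der (table_mx C (raise_table i)) (x 1) =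
    0, der (table_mx C (raise_table i)) zeta1 = 0 &
      der (table_mx C (raise_table i)) zeta2 = 0].
Proof.
move=> i6; rewrite raisingE // /zeta1 /zeta2 !(derDr, derNr, derMn, derM).
case: i i6 => [|[|[|[|[|[|//]]]]]] _; rewrite /nth !der_var //=;
  rewrite !(big_cons, big_nil, scaler_int) /=; by split; ring.
Qed.
End SingularPolynomials.

(** * Weights of the singular polynomials and the Laplacian form *)

Section SingularFamily.
Variable C : numClosedFieldType.
Local Notation A := {mpoly C[26]}.
Local Notation x r := ('X_(xvar r) : A).
Local Notation K := (table_mx C lap_table).
Implicit Types (p q : A) (M : 'M[C]_26).

Definition xweight (i r : nat) : int := lform (coroot i) (nth [::] weights r.-1).

Lemma bounded_cartan_table h : all bounded (cartan_table h).
Proof.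
rewrite /cartan_table /mkseq all_map; apply/allP => r; rewrite mem_iota => r26.
by rewrite /= andbT.
Qed.

Lemma der_cartan_var i r : (0 < r < 27)%N ->
  der (table_mx C (coroot_table i)) (x r) = x r *~ xweight i r.
Proof.
move=> r27; rewrite (der_var C r27 (bounded_cartan_table _)).
case: r r27 => // r r27.
by rewrite nth_mkseq // big_seq1 scaler_int.
Qed.

(** All monomials of [zeta1], and all those of [zeta2], have the same weight. *)
Lemma xweight_zeta i : (i < 6)%N ->
  [/\ xweight i 12 = xweight i 1 - xweight i 2,
      xweight i 10 = xweight i 1 - xweight i 3,
      xweight i 8 = xweight i 1 - xweight i 4
    & xweight i 6 = xweight i 1 - xweight i 5] /\
  [/\ xweight i 13 = 0, xweight i 14 = 0,
      xweight i 15 = xweight i 2 - xweight i 1,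
      xweight i 11 = xweight i 2 - xweight i 3
    & xweight i 9 = xweight i 2 - xweight i 4 /\ xweight i 7 =
      xweight i 2 - xweight i 6].
Proof. by case: i => [|[|[|[|[|[|//]]]]]] _; vm_compute. Qed.

Lemma zeta_weight i : (i < 6)%N ->
  der (table_mx C (coroot_table i)) (zeta1 C) = zeta1 C *~ xweight i 1 /\
  der (table_mx C (coroot_table i)) (zeta2 C) = zeta2 C *~ (xweight i 1 + xweight i 2).
Proof.
move=> i6; have [[E12 E10 E8 E6] [E13 E14 E15 E11 [E9 E7]]] := xweight_zeta i6.
rewrite /zeta1 /zeta2 !(derDr, derNr, derMn, derM) !der_cartan_var //.
rewrite E12 E10 E8 E6 E13 E14 E15 E11 E9 E7 E6.
by split; ring.
Qed.

Lemma der_weight_mul M p q (a b : int) : der M p = p *~ a -> der M q = q *~ b ->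
  der M (p * q) = (p * q) *~ (a + b).
Proof. by move=> dp dq; rewrite derM dp dq; ring. Qed.

Lemma der_weight_exp M p n (a : int) :
  der M p = p *~ a -> der M (p ^+ n) = (p ^+ n) *~ (n%:Z * a).
Proof.
move=> dp; elim: n => [|n IH]; first by rewrite expr0 der1 mul0r.
by rewrite exprS (der_weight_mul dp IH) intS mulrDl mul1r.
Qed.

Lemma der_mul0 M p q : der M p = 0 -> der M q = 0 -> der M (p * q) = 0.
Proof. by move=> dp dq; rewrite derM dp dq mul0r mulr0 addr0. Qed.

Lemma der_exp0 M p n : der M p = 0 -> der M (p ^+ n) = 0.
Proof.
by move=> dp; elim: n => [|n IH]; rewrite ?expr0 ?der1 // exprS der_mul0.
Qed.

Lemma lap_sym : K^T = K.
Proof. by rewrite -table_mx_tr; apply: table_mx_eq; vm_compute. Qed.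

Definition lap_entry (r s : nat) : int :=
  if (r + s == 27)%N then 1 else
  if (r == s) && (r \in [:: 13; 14])%N then -2 else 0.

Lemma gamma_var r s : (0 < r < 27)%N -> (0 < s < 27)%N ->
  gamma K (x r) (x s) = (lap_entry r s)%:~R.
Proof.
case: r s => // r [] // s r26 s26; rewrite gammaX mxE /xvar /= !inordK //.
rewrite -[RHS](rmorph_int (@mpolyC 26 C)) /=; congr ((_%:~R)%:MP).
have /allP/(_ r)/(_ _)/allP/(_ s)/(_ _)/eqP h : all (fun r => all (fun s =>
  coef (nth [::] lap_table r) s == lap_entry r.+1 s.+1) (iota 0 26)) (iota 0 26) by
    vm_compute.
by apply: h; rewrite mem_iota.
Qed.

Lemma gammaMl p q q' : gamma K (q * q') p = gamma K q p * q' + q * gamma K q' p.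
Proof. by rewrite gammaC ?lap_sym // gammaMr !(gammaC p) ?lap_sym. Qed.

Lemma gammaDl p q q' : gamma K (q + q') p = gamma K q p + gamma K q' p.
Proof. by rewrite gammaC ?lap_sym // raddfD /= !(gammaC p) ?lap_sym. Qed.

Lemma gammaNl p q : gamma K (- q) p = - gamma K q p.
Proof. by rewrite gammaC ?lap_sym // raddfN /= !(gammaC p) ?lap_sym. Qed.

Lemma gammaMnl p q n : gamma K (q *+ n) p = gamma K q p *+ n.
Proof. by rewrite gammaC ?lap_sym // raddfMn /= !(gammaC p) ?lap_sym. Qed.

Lemma gammaDr p q q' : gamma K p (q + q') = gamma K p q + gamma K p q'.
Proof. exact: raddfD. Qed.
Lemma gammaNr p q : gamma K p (- q) = - gamma K p q.
Proof. exact: raddfN. Qed.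
Lemma gammaMnr p q n : gamma K p (q *+ n) = gamma K p q *+ n.
Proof. exact: raddfMn. Qed.

Lemma gamma_x1 :
  [/\ gamma K (x 1) (x 1) = 0, gamma K (x 1) (zeta1 C) = 0 &
      gamma K (x 1) (zeta2 C) = 0].
Proof.
rewrite /zeta1 /zeta2 !(gammaDr, gammaNr, gammaMnr, gammaMr) !gamma_var //.
by rewrite /lap_entry /=; split; ring.
Qed.

(** Up to the matrix [lap_table], this is the gradient of [zeta2]; only four of
    its entries survive, since no variable of index larger than 15 occurs. *)
Lemma gamma_var_zeta2 r : (0 < r < 16)%N ->
  gamma K (x r) (zeta2 C) =
    if r == 12 then x 1 * x 1 else if r == 13 then (x 1 * x 2) *+ 2
    else if r == 14 then - (x 1 * x 2) else if r == 15 then x 2 * x 2 else 0.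
Proof.
move=> r16; have r27 : (0 < r < 27)%N by lia.
rewrite /zeta2 !(gammaDr, gammaNr, gammaMr) !gamma_var //.
by case: r r16 r27 => [|[|[|[|[|[|[|[|[|[|[|[|[|[|[|[|//]]]]]]]]]]]]]]]] _ _;
  rewrite /lap_entry /=; ring.
Qed.

End SingularFamily.

(** * Harmonic monomials in the singular polynomials *)

Section HarmonicFamily.
Variable C : numClosedFieldType.
Local Notation A := {mpoly C[26]}.
Local Notation x r := ('X_(xvar r) : A).
Local Notation K := (table_mx C lap_table).
Implicit Types (p q : A) (M : 'M[C]_26).

Lemma gamma_zeta2 :
  gamma K (zeta1 C) (zeta2 C) = 0 /\ gamma K (zeta2 C) (zeta2 C) = 0.
Proof.
suff h z : (forall r, (0 < r < 16)%N -> gamma K (x r) z =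
    if r == 12 then x 1 * x 1 else if r == 13 then (x 1 * x 2) *+ 2
    else if r == 14 then - (x 1 * x 2) else if r == 15 then x 2 * x 2 else 0) ->
    gamma K (zeta1 C) z = 0 /\ gamma K (zeta2 C) z = 0.
  by apply: h => r; exact: gamma_var_zeta2.
move=> G; rewrite /zeta1 /zeta2 !(gammaDl, gammaNl, gammaMnl, gammaMl) !G //=.
by split; ring.
Qed.

Lemma diff2_zeta : diff2 K (zeta1 C) = 0 /\ diff2 K (zeta2 C) = 0.
Proof.
have dD p q : diff2 K (p + q) = diff2 K p + diff2 K q by exact: raddfD.
have dN p : diff2 K (- p) = - diff2 K p by exact: raddfN.
have dMn p n : diff2 K (p *+ n) = diff2 K p *+ n by exact: raddfMn.
rewrite /zeta1 /zeta2 !(dD, dN, dMn) !(diff2M _ _ (lap_sym C)) !diff2X.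
by rewrite !gammaMl !gamma_var // /lap_entry /=; split; ring.
Qed.

Lemma diff2_mul p q : diff2 K p = 0 -> diff2 K q = 0 -> gamma K p q = 0 ->
  diff2 K (p * q) = 0.
Proof.
by move=> p0 q0 pq0; rewrite (diff2M _ _ (lap_sym C)) p0 q0 pq0 mul0r mulr0 mul0rn
  !addr0.
Qed.

Lemma gamma_exp p q n : gamma K p q = 0 -> gamma K p (q ^+ n) = 0.
Proof.
move=> pq0; elim: n => [|n IH].
  apply: (addIr (gamma K p 1)); rewrite expr0 add0r.
  by have := gammaMr K p 1 1; rewrite !mulr1 mul1r => <-.
by rewrite exprS gammaMr pq0 IH mul0r mulr0 addr0.
Qed.

Lemma gamma_mul p q q' : gamma K p q = 0 -> gamma K p q' = 0 -> gamma K p (q * q') = 0.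
Proof. by move=> h h'; rewrite gammaMr h h' mul0r mulr0 addr0. Qed.

Lemma diff2_exp p n : diff2 K p = 0 -> gamma K p p = 0 -> diff2 K (p ^+ n) = 0.
Proof.
move=> p0 pp0; elim: n => [|n IH].
  rewrite expr0 /diff2 big1 // => r _; rewrite big1 // => s _.
  by rewrite -mpolyC1 mderivC mderiv0 scaler0.
by rewrite exprS diff2_mul // gamma_exp.
Qed.

Definition zeta_monomial (a b c : nat) : A := x 1 ^+ a * zeta1 C ^+ b * zeta2 C ^+ c.

Lemma zeta_monomial_diff2 a b c : (b < 2)%N -> diff2 K (zeta_monomial a b c) = 0.
Proof.
move=> b2; have [xx xz1 xz2] := gamma_x1 C; have [z12 z22] := gamma_zeta2.
have [dz1 dz2] := diff2_zeta.
have gC p q : gamma K p q = gamma K q p by apply: gammaC; exact: lap_sym.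
have dx : diff2 K (x 1 ^+ a) = 0 by apply: diff2_exp => //; exact: diff2X.
have g2 p : gamma K p (zeta2 C) = 0 -> gamma K p (zeta2 C ^+ c) = 0 by exact: gamma_exp.
have g21 : gamma K (x 1 ^+ a) (zeta2 C ^+ c) = 0.
  by apply: gamma_exp; rewrite gC; apply: gamma_exp; rewrite gC.
have g11 : gamma K (x 1 ^+ a) (zeta1 C) = 0 by rewrite gC; apply: gamma_exp; rewrite gC.
rewrite /zeta_monomial; apply: diff2_mul; last 1 first.
- rewrite gC; apply: gamma_mul; first by rewrite gC.
  by apply: gamma_exp; rewrite gC; apply: gamma_exp.
- apply: diff2_mul => //; last by apply: gamma_exp.
  case: b b2 => [|[|//]] _; last by rewrite expr1.
  by apply: (diff2_exp (p := x 1) 0) => //; exact: diff2X.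
by apply: diff2_exp.
Qed.

Lemma laplacian_diff2 p : diff2 K p = laplacian p *+ 2.
Proof.
pose d i j := p^`M(xvar i)^`M(xvar j).
have dC i j : d i j = d j i by exact: mderiv_comm.
have -> : diff2 K p = \sum_(0 <= r < 26) \sum_(y <- nth [::] lap_table r) d r.+1
  y.1.+1 *~ y.2.
  rewrite big_mkord; apply: eq_bigr => r _.
  under eq_bigr => s _ do rewrite mxE.
  rewrite sum_coef big_seq [RHS]big_seq; apply: eq_bigr => y yr; rewrite scaler_int.
  have /allP/(_ r)/(_ _)/allP/(_ y yr) y26 :
    all (fun r => all (fun y => y.1 < 26)%N (nth [::] lap_table r)) (iota 0 26).
    by vm_compute.
  have {}y26 : (y.1 < 26)%N by apply: y26; rewrite mem_iota ltn_ord.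
  rewrite insubT /d /xvar /= inord_val; congr (_^`M(_) *~ _).
  by apply: val_inj; rewrite /= inordK.
rewrite /laplacian unlock /= -!/(d _ _).
rewrite (dC 26 1) (dC 25 2) (dC 24 3) (dC 23 4) (dC 22 5) (dC 21 6) (dC 20 7) (dC 19 8)
  (dC 18 9) (dC 17 10) (dC 16 11) (dC 15 12) (dC 14 13).
by clearbody d; ring.
Qed.

Lemma zeta_monomial_singular i a b c : (i < 6)%N ->
  der (table_mx C (raise_table i)) (zeta_monomial a b c) = 0.
Proof.
move=> i6; have [sx s1 s2] := zeta_singular C i6.
by rewrite /zeta_monomial !der_mul0 ?der_exp0.
Qed.

Lemma zeta_monomial_weight i a b c : (i < 6)%N ->
  der (table_mx C (coroot_table i)) (zeta_monomial a b c) = zeta_monomial a b c *~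
    ((a + b)%:Z * xweight i 1 + c%:Z * (xweight i 1 + xweight i 2)).
Proof.
move=> i6; have [w1 w2] := zeta_weight C i6; have wx := der_cartan_var C i (r := 1) isT.
rewrite /zeta_monomial (der_weight_mul (der_weight_mul (der_weight_exp a wx)
  (der_weight_exp b w1)) (der_weight_exp c w2)).
by congr (_ *~ _); rewrite PoszD; ring.
Qed.

Lemma zeta_monomial_homog a b c : zeta_monomial a b c \is (a + 2 * b + 3 * c)%N.-homog.
Proof.
have hx r : x r \is 1.-homog by rewrite dhomogX /= mdeg1.
have h2 r s : x r * x s \is 2.-homog by exact: (@dhomogM _ _ _ 1 _ 1).
have h3 r s t : x r * x s * x t \is 3.-homog by exact: (@dhomogM _ _ _ 2 _ 1).
have z1 : zeta1 C \is 2.-homog.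
  have sum4 : x 2 * x 12 + x 3 * x 10 - x 4 * x 8 + x 5 * x 6 \is 2.-homog.
    by apply: rpredD => //; apply: rpredB => //; apply: rpredD.
  by apply: rpredB => //; apply: rpredB; apply: rpredMn.
have z2 : zeta2 C \is 3.-homog.
  by rewrite /zeta2; do 8?[apply: rpredB => //|apply: rpredD => //].
have := dhomogM (dhomogM (dhomogMn a (hx 1%N)) (dhomogMn b z1)) (dhomogMn c z2).
by rewrite mul1n.
Qed.

(** The two singular polynomials take the values 3 and 1 at the point with all
    coordinates 1. *)
Lemma zeta_monomial_neq0 a b c : zeta_monomial a b c != 0.
Proof.
have ev0 p : p.@[fun=> 1] != 0 -> p != 0.
  by apply: contraNneq => ->; rewrite meval0.
rewrite /zeta_monomial !mulf_neq0 ?expf_neq0 //; apply: ev0.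
- by rewrite mevalXU oner_eq0.
- rewrite /zeta1 !(mevalD, mevalN, mevalMn, mevalM, mevalXU, mevalB).
  by rewrite [X in X != 0](_ : _ = 3%:R) ?pnatr_eq0 //; ring.
rewrite /zeta2 !(mevalD, mevalN, mevalMn, mevalM, mevalXU, mevalB).
by rewrite [X in X != 0](_ : _ = 1%:R) ?pnatr_eq0 //; ring.
Qed.
End HarmonicFamily.

(** * The number of irreducible summands *)

Lemma table_lap_invariant (C : numClosedFieldType) t : (size t <= 26)%N ->
  table_eq (table_mul t lap_table) (table_scale (-1) (table_mul lap_table (table_tr
    t))) ->
  table_mx C t *m table_mx C lap_table + table_mx C lap_table *m (table_mx C t)^T = 0.
Proof.
move=> t26 /(table_mx_eq C); rewrite table_mx_scale table_mx_mul ?size_mkseq // => ->.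
by rewrite table_mx_mul ?size_mkseq // table_mx_tr rmorphN1 scaleN1r addNr.
Qed.

(** The first and third coroots take the values [a + b] and [c] on
    [zeta_monomial a b c]. *)
Lemma zeta_monomial_weight_inj k (b b' c c' : nat) : (b < 2)%N -> (b' < 2)%N ->
  (2 * b + 3 * c <= k)%N -> (2 * b' + 3 * c' <= k)%N ->
  (forall i, (i < 6)%N ->
    (k - 2 * b - 3 * c + b)%:Z * xweight i 1 + c%:Z * (xweight i 1 + xweight i 2) =
    (k - 2 * b' - 3 * c' + b')%:Z * xweight i 1 + c'%:Z * (xweight i 1 + xweight i
      2)) ->
  b = b' /\ c = c'.
Proof.
move=> b2 b2' le le' E.
have w01 : xweight 0 1 = 1 by vm_compute.
have w02 : xweight 0 2 = -1 by vm_compute.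
have w21 : xweight 2 1 = 0 by vm_compute.
have w22 : xweight 2 2 = 1 by vm_compute.
have := E 0%N isT; have := E 2%N isT; rewrite w01 w02 w21 w22; lia.
Qed.

Theorem corollary3p4 (R : realType) (k : nat) (hk : (2 <= k)%N) :
  (exists (n : nat) (W : 'I_n -> {vspace polyA R[i] k}),
     irreducible_decomposition (harmonic R[i] k) W)
  /\ (forall (n : nat) (W : 'I_n -> {vspace polyA R[i] k}),
        irreducible_decomposition (harmonic R[i] k) W ->
        (k %/ 3 + (k - 2) %/ 3 + 2 <= n)%N).
Proof.
have harmP (f : polyA R[i] k) :
    (f \in harmonic R[i] k) = (diff2 (table_mx R[i] lap_table) (val f) == 0).
  by rewrite harmonicE laplacian_diff2 -scaler_nat scaler_eq0 pnatr_eq0.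
split.
  apply: decomposition_exists => i i6.
  have kill t (f : polyA R[i] k) : (size t <= 26)%N ->
      table_eq (table_mul t lap_table) (table_scale (-1) (table_mul lap_table
        (table_tr t))) ->
      f \in harmonic R[i] k -> homog_der (table_mx R[i] t) f \in harmonic R[i] k.
    move=> t26 inv; rewrite !harmP /= => /eqP f0.
    by rewrite diff2_der ?f0 ?linear0 //; exact: table_lap_invariant.
  split=> f; apply: kill; try exact: size_root_table.
    by have /allP h := raise_table_lap; apply: h; rewrite mem_iota.
  by have /allP h := lower_table_lap; apply: h; rewrite mem_iota.
move=> n W dW.
(* the values of [c] for [b = 0] and for [b = 1] *)
pose J : finType := ('I_(k %/ 3).+1 + 'I_((k - 2) %/ 3).+1)%type.
pose bc (j : J) : nat * nat :=
  match j with inl c => (0%N, c : nat) | inr c => (1%N, c : nat) end.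
have bc_lt j : ((bc j).1 < 2)%N by case: j.
have bc_le j : (2 * (bc j).1 + 3 * (bc j).2 <= k)%N.
  by case: j => [[c c_lt]|[c c_lt]] /=; lia.
pose a j := (k - 2 * (bc j).1 - 3 * (bc j).2)%N.
have hom j : zeta_monomial R[i] (a j) (bc j).1 (bc j).2 \is k.-homog.
  have := zeta_monomial_homog R[i] (a j) (bc j).1 (bc j).2.
  rewrite (_ : (_ + _)%N = k) //; have := bc_le j; rewrite /a; lia.
have -> : (k %/ 3 + (k - 2) %/ 3 + 2 = #|J|)%N.
  by rewrite card_sum !card_ord; lia.
apply: (singular_count (v := fun j => DHomog (hom j)) (c := fun j i =>
    (a j + (bc j).1)%:Z * xweight i 1 + (bc j).2%:Z * (xweight i 1 + xweight i 2)) dW).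
- by move=> j; rewrite harmP /= zeta_monomial_diff2.
- by move=> j; rewrite -(inj_eq val_inj) /= zeta_monomial_neq0.
- by move=> j i i6; apply: val_inj; exact: zeta_monomial_singular.
- by move=> j i i6; apply: val_inj; rewrite /= zeta_monomial_weight // scaler_int.
move=> j j' /(zeta_monomial_weight_inj (bc_lt j) (bc_lt j') (bc_le j) (bc_le j')).
by case: j j' {bc_lt bc_le a hom} => [c|c] [c'|c'] /= [] // _ /val_inj ->.
Qed.
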